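(* Assume that the data are sufficiently small so that $$\Big(1+\frac{2}{\alpha_S}\|\mathbf g\|_{0,3/2;\Omega}\Big)\frac{2}{\alpha_T}\,\|\varphi_D\|_{1/2,\Gamma_D}\le R .$$ In addition, suppose that $$\mathsf L\Big\{\Big(\|\mathbf g\|_{0,3/2;\Omega}+\big(1+\|\mathbf g\|_{0,3/2;\Omega}(1+\|\varphi_D\|_{1/2,\Gamma_D})\big)\|\varphi_D\|_{1/2,\Gamma_D}\Big)+\Big(1+\|\mathbf g\|_{0,3/2;\Omega}(1+\|\varphi_D\|_{1/2,\Gamma_D})\Big)\big(1+\|\varphi_D\|_{1/2+\epsilon,\Gamma_D}\big)\Big\}<1 .$$ Then the operator $\mathcal L$ has a unique fixed point $(\mathbf u,\varphi)\in \mathbf W(R)$. Equivalently, the coupled problem (P) has a unique solution $(\boldsymbol\sigma,\vec{\mathbf u})\in\mathbb X\times\mathcal Z$, $(\boldsymbol\rho,\varphi)\in\mathbf X\times \mathrm Y$ with $\vec{\mathbf u}=(\mathbf u,\boldsymbol\gamma)$ and $(\mathbf u,\varphi)\in\mathbf W(R)$. Moreover, $$\|(\boldsymbol\sigma,\vec{\mathbf u})\|\le \frac{4}{\alpha_S\,\alpha_T}\,\|\varphi_D\|_{1/2,\Gamma_D}\,\|\mathbf g\|_{0,3/2;\Omega}\qquad\text{and}\qquad \|(\boldsymbol\rho,\varphi)\|\le\frac{2}{\alpha_T}\,\|\varphi_D\|_{1/2,\Gamma_D}.$$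
   Context: **Data.** $\Omega\subset\mathbb R^2$ is a bounded polygonal domain with boundary $\Gamma=\Gamma_D\cup\Gamma_N$ and outward unit normal $\mathbf n$; $\mathbf g\in L^\infty(\Omega)^2$; $\varphi_D\in H^{1/2}(\Gamma_D)$. The functions $\mu,\kappa:\mathbb R\to\mathbb R^+$ satisfy $\mu_1\le\mu\le\mu_2$, $\kappa_1\le\kappa\le\kappa_2$ with positive constants, and are Lipschitz with constants $L_\mu,L_\kappa$. $\|\cdot\|_{0,p;\Omega}$ is the $L^p$ norm, $\|\cdot\|_{0,\Omega}$ the $L^2$ norm, $\|\cdot\|_{s,p;\Omega}$ the $W^{s,p}$ norm, $\|\cdot\|_{s,\Omega}$ the $H^s$ norm (same for vectors and tensors). For tensors, $\boldsymbol\tau^{\mathtt d}=\boldsymbol\tau-\frac12\mathrm{tr}(\boldsymbol\tau)\mathbb I$, and $(\mathbf z\otimes\mathbf w)_{ij}=z_iw_j$; $\mathbf{div}$ is the row-wise divergence. **Spaces.** $\mathbb X=\{\boldsymbol\tau\in L^2(\Omega)^{2\times2}:\mathbf{div}(\boldsymbol\tau)\in L^{6/5}(\Omega)^2,\ \int_\Omega\mathrm{tr}(\boldsymbol\tau)=0\}$ with norm $\|\boldsymbol\tau\|_{\mathbf{div}_{6/5},\Omega}=\|\boldsymbol\tau\|_{0,\Omega}+\|\mathbf{div}(\boldsymbol\tau)\|_{0,6/5;\Omega}$; $\mathbf X=\{\boldsymbol\eta\in L^2(\Omega)^2:\mathrm{div}(\boldsymbol\eta)\in L^{6/5}(\Omega),\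 \boldsymbol\eta\cdot\mathbf n=0\text{ on }\Gamma_N\}$ with norm $\|\boldsymbol\eta\|_{\mathrm{div}_{6/5},\Omega}=\|\boldsymbol\eta\|_{0,\Omega}+\|\mathrm{div}(\boldsymbol\eta)\|_{0,6/5;\Omega}$; $\mathbf Y=L^6(\Omega)^2$; $\mathrm Y=L^6(\Omega)$; $\mathbb Z=\{\boldsymbol\omega\in L^2(\Omega)^{2\times 2}:\boldsymbol\omega+\boldsymbol\omega^{\mathtt t}=0\}$; $\mathcal Z=\mathbf Y\times\mathbb Z$ with elements $\vec{\mathbf v}=(\mathbf v,\boldsymbol\omega)$ and norm $\|\mathbf v\|_{0,6;\Omega}+\|\boldsymbol\omega\|_{0,\Omega}$. Product spaces carry the sum norms. **Forms.** For $\phi\in\mathrm Y$, $\mathbf z\in\mathbf Y$: $A^S_\phi(\boldsymbol\zeta,\boldsymbol\tau)=\int_\Omega\frac1{\mu(\phi)}\boldsymbol\zeta^{\mathtt d}:\boldsymbol\tau^{\mathtt d}$, $O^S_\phi(\mathbf z;\mathbf w,\boldsymbol\tau)=\int_\Omega\frac1{\mu(\phi)}(\mathbf z\otimes\mathbf w)^{\mathtt d}:\boldsymbol\tau$, $B^S(\boldsymbol\tau,\vec{\mathbf v})=\int_\Omega\mathbf v\cdot\mathbf{div}(\boldsymbol\tau)+\int_\Omega\boldsymbol\omega:\boldsymbol\tau$, $A^T_\phi(\boldsymbol\xi,\boldsymbol\eta)=\int_\Omega\frac1{\kappa(\phi)}\boldsymbol\xi\cdot\boldsymbol\eta$, $O^T_\phi(\mathbf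 z;\omega,\boldsymbol\eta)=\int_\Omega\frac1{\kappa(\phi)}\omega\,\mathbf z\cdot\boldsymbol\eta$, $B^T(\boldsymbol\eta,\psi)=\int_\Omega\psi\,\mathrm{div}(\boldsymbol\eta)$, $F^T(\boldsymbol\eta)=\langle\boldsymbol\eta\cdot\mathbf n,\varphi_D\rangle_{\Gamma_D}$. The norm on $H^{1/2}(\Gamma_D)$ is normalized so that $|F^T(\boldsymbol\eta)|\le\|\varphi_D\|_{1/2,\Gamma_D}\|\boldsymbol\eta\|_{\mathrm{div}_{6/5},\Omega}$. **Problem (P).** Find $(\boldsymbol\sigma,\vec{\mathbf u})\in\mathbb X\times\mathcal Z$, $(\boldsymbol\rho,\varphi)\in\mathbf X\times\mathrm Y$ such that for all $\boldsymbol\tau\in\mathbb X$, $\vec{\mathbf v}\in\mathcal Z$, $\boldsymbol\eta\in\mathbf X$, $\psi\in\mathrm Y$: $A^S_\varphi(\boldsymbol\sigma,\boldsymbol\tau)+O^S_\varphi(\mathbf u;\mathbf u,\boldsymbol\tau)+B^S(\boldsymbol\tau,\vec{\mathbf u})=0$; $B^S(\boldsymbol\sigma,\vec{\mathbf v})=-\int_\Omega\varphi\,\mathbf g\cdot\mathbf v$; $A^T_\varphi(\boldsymbol\rho,\boldsymbol\eta)+O^T_\varphi(\mathbf u;\varphi,\boldsymbol\eta)+B^T(\boldsymbol\eta,\varphi)=F^T(\boldsymbol\eta)$; $B^T(\boldsymbol\rho,\psi)=0$. **Constants and radius.** $\alpha_S,\alpha_T>0$ are constants, independent of $\phi\in\mathrm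 Y$, such that $\sup_{(\boldsymbol\tau,\vec{\mathbf v})\ne0}\frac{A^S_\phi(\boldsymbol\zeta,\boldsymbol\tau)+B^S(\boldsymbol\tau,\vec{\mathbf w})+B^S(\boldsymbol\zeta,\vec{\mathbf v})}{\|(\boldsymbol\tau,\vec{\mathbf v})\|}\ge\alpha_S\|(\boldsymbol\zeta,\vec{\mathbf w})\|$ for all $(\boldsymbol\zeta,\vec{\mathbf w})\in\mathbb X\times\mathcal Z$, and $\sup_{(\boldsymbol\eta,\psi)\neq0}\frac{A^T_\phi(\boldsymbol\xi,\boldsymbol\eta)+B^T(\boldsymbol\eta,\omega)+B^T(\boldsymbol\xi,\psi)}{\|(\boldsymbol\eta,\psi)\|}\ge\alpha_T\|(\boldsymbol\xi,\omega)\|$ for all $(\boldsymbol\xi,\omega)\in\mathbf X\times\mathrm Y$. Set $r_1=\frac{\mu_1\alpha_S}{2|\Omega|^{1/6}}$, $r_2=\frac{\kappa_1\alpha_T}{2|\Omega|^{1/6}}$, $R=\min\{r_1,r_2\}$, and $\mathbf W(R)=\{(\mathbf z,\phi)\in\mathbf Y\times\mathrm Y:\|\mathbf z\|_{0,6;\Omega}+\|\phi\|_{0,6;\Omega}\le R\}$. **Operators.** For $\|\mathbf z\|_{0,6;\Omega}\le r_1$ and $\phi\in \mathrm Y$, $\mathcal L^S(\mathbf z,\phi)=(\boldsymbol\sigma_\star,(\mathbf u_\star,\boldsymbol\gamma_\star))$ is the unique solution in $\mathbb X\times\mathcal Z$ of $A^S_\phi(\boldsymbol\sigma_\star,\boldsymbol\tau)+O^S_\phi(\mathbf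 z;\mathbf u_\star,\boldsymbol\tau)+B^S(\boldsymbol\tau,\vec{\mathbf u}_\star)=0$, $B^S(\boldsymbol\sigma_\star,\vec{\mathbf v})=-\int_\Omega\phi\,\mathbf g\cdot\mathbf v$; for $\|\mathbf z\|_{0,6;\Omega}\le r_2$, $\mathcal L^T(\mathbf z,\phi)=(\boldsymbol\rho_\star,\varphi_\star)$ is the unique solution in $\mathbf X\times\mathrm Y$ of $A^T_\phi(\boldsymbol\rho_\star,\boldsymbol\eta)+O^T_\phi(\mathbf z;\varphi_\star,\boldsymbol\eta)+B^T(\boldsymbol\eta,\varphi_\star)=F^T(\boldsymbol\eta)$, $B^T(\boldsymbol\rho_\star,\psi)=0$ (all test functions). With $\mathcal L^S_2$ the $\mathbf u_\star$ component and $\mathcal L^T_2$ the $\varphi_\star$ component, $\mathcal L(\mathbf z,\phi)=\big(\mathcal L^S_2(\mathbf z,\mathcal L^T_2(\mathbf z,\phi)),\mathcal L^T_2(\mathbf z,\phi)\big)$. **Standing regularity assumption.** There are $\epsilon\in[\frac13,1)$ and constants $C_\epsilon,\widetilde C_\epsilon>0$, with $\varphi_D\in H^{1/2+\epsilon}(\Gamma_D)$, such that whenever $\mathcal L^S(\mathbf z,\phi)$, resp. $\mathcal L^T(\mathbf z,\phi)$, is defined: $\boldsymbol\sigma_\star\in H^\epsilon(\Omega)^{2\times 2}$, $\mathbf u_\star\in W^{\epsilon,6}(\Omega)^2$ with $\|\boldsymbol\sigma_\star\|_{\epsilon,\Omega}+\|\mathbf u_\star\|_{\epsilon,6;\Omega}\le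 C_\epsilon\|\mathbf g\|_{0,3/2;\Omega}\|\phi\|_{0,6;\Omega}$; resp. $\boldsymbol\rho_\star\in H^\epsilon(\Omega)^2$, $\varphi_\star\in W^{\epsilon,6}(\Omega)$ with $\|\boldsymbol\rho_\star\|_{\epsilon,\Omega}+\|\varphi_\star\|_{\epsilon,6;\Omega}\le\widetilde C_\epsilon\|\varphi_D\|_{1/2+\epsilon,\Gamma_D}$. **The constant $\mathsf L$.** $\mathsf L>0$ is the Lipschitz-type constant of $\mathcal L$, i.e. a constant for which, for all $(\mathbf z,\phi),(\mathbf y,\varpi)\in\mathbf W(R)$, $\|\mathcal L(\mathbf z,\phi)-\mathcal L(\mathbf y,\varpi)\|\le\mathsf L\{(\|\mathbf g\|_{0,3/2;\Omega}+(1+\|\mathbf g\|_{0,3/2;\Omega}(1+\|\varphi_D\|_{1/2,\Gamma_D}))\|\varphi_D\|_{1/2,\Gamma_D})\|\mathbf z-\mathbf y\|_{0,6;\Omega}+(1+\|\mathbf g\|_{0,3/2;\Omega}(1+\|\varphi_D\|_{1/2,\Gamma_D}))(1+\|\varphi_D\|_{1/2+\epsilon,\Gamma_D})\|\phi-\varpi\|_{0,6;\Omega}\}$. *)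

(* Defs.v *)
From HB Require Import structures.
From mathcomp Require Import all_boot all_order all_algebra.
From mathcomp Require Import all_classical all_reals all_analysis.
Set Implicit Arguments.
Unset Strict Implicit.
Unset Printing Implicit Defensive.
Import Order.TTheory GRing.Theory Num.Theory.
Import numFieldNormedType.Exports.
Local Open Scope classical_set_scope.
Local Open Scope ring_scope.

(* Elements of Lebesgue and Sobolev spaces on Omega are represented by
   functions on the whole plane of which only the restriction to Omega matters;
   two representatives stand for the same element when they agree almost
   everywhere on Omega. Norms are obtained with [fine] and are meaningful only
   together with the corresponding membership predicate. *)

Section Fields.
Context {R : realType}.

Definition leb2 :
    {measure set (measurableTypeR R * measurableTypeR R) -> \bar R} :=
  (@lebesgue_measure R \x @lebesgue_measure R)%E.

Definition mxdot m n (A B : 'M[R]_(m, n)) : R := \sum_i \sum_j A i j * B i j.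

Definition frob m n (A : 'M[R]_(m, n)) : R := Num.sqrt (mxdot A A).

Definition euclid (x : R * R) : R := Num.sqrt (x.1 ^+ 2 + x.2 ^+ 2).

Definition dev (A : 'M[R]_2) : 'M[R]_2 := A - (2^-1 * \tr A)%:M.

Definition scalar_field := R * R -> R.
Definition vector_field := R * R -> 'rV[R]_2.
Definition tensor_field := R * R -> 'M[R]_2.

Variable Omega : set (R * R).

Definition ae_eq_on U (f g : R * R -> U) : Prop := ae_eq leb2 Omega f g.

Definition in_Lp (p : \bar R) (f : scalar_field) : Prop :=
  (f \_ Omega) \in Lfun leb2 p.

Definition Lp_norm (p : R) (f : scalar_field) : R :=
  fine ('N[leb2]_p%:E [EFin \o (f \_ Omega)]).

Definition in_Lp_mx m n (p : \bar R) (F : R * R -> 'M[R]_(m, n)) : Prop :=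
  forall i j, in_Lp p (fun x => F x i j).

Definition Lp_norm_mx m n (p : R) (F : R * R -> 'M[R]_(m, n)) : R :=
  Lp_norm p (fun x => frob (F x)).

(* The p-th power of the Sobolev-Slobodeckij seminorm of order s in dimension
   2, [delta x y] being the length of the increment of the field. *)
Definition slobodeckij (s p : R) (delta : R * R -> R * R -> R) : \bar R :=
  (\int[leb2]_(x in Omega) \int[leb2]_(y in Omega)
     (delta x y `^ p / euclid (x - y) `^ (2 + s * p))%:E)%E.

Definition slob (s p : R) (f : scalar_field) : \bar R :=
  slobodeckij s p (fun x y => `|f x - f y|).

Definition slob_mx m n (s p : R) (F : R * R -> 'M[R]_(m, n)) : \bar R :=
  slobodeckij s p (fun x y => frob (F x - F y)).

(* W^{s,p}(Omega) for 0 < s < 1. *)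
Definition in_Wsp (s p : R) (f : scalar_field) : Prop :=
  in_Lp p%:E f /\ (slob s p f < +oo)%E.

Definition Wsp_norm (s p : R) (f : scalar_field) : R :=
  (Lp_norm p f `^ p + fine (slob s p f)) `^ p^-1.

Definition in_Wsp_mx m n (s p : R) (F : R * R -> 'M[R]_(m, n)) : Prop :=
  in_Lp_mx p%:E F /\ (slob_mx s p F < +oo)%E.

Definition Wsp_norm_mx m n (s p : R) (F : R * R -> 'M[R]_(m, n)) : R :=
  (Lp_norm_mx p F `^ p + fine (slob_mx s p F)) `^ p^-1.

Definition grad (f : scalar_field) : vector_field :=
  fun x => \row_(i < 2) 'D_(if i == ord0 then (1, 0) else (0, 1)) f x.

Definition smooth (f : scalar_field) : Prop :=
  forall vs : seq (R * R),
    let g := foldr (fun v h => 'D_v h) f vs in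
    continuous g /\ forall x v, derivable g x v.

Definition test_function (psi : scalar_field) : Prop :=
  smooth psi /\
  let supp := closure [set x | psi x != 0] in compact supp /\ supp `<=` Omega.

Definition in_L1loc (f : scalar_field) : Prop :=
  forall K : set (R * R), compact K -> K `<=` Omega ->
    leb2.-integrable K (EFin \o f).

Definition is_wgrad (w : scalar_field) (G : vector_field) : Prop :=
  (forall i, in_L1loc (fun x => G x 0 i)) /\
  forall psi, test_function psi -> forall i,
    \int[leb2]_(x in Omega) (w x * grad psi x 0 i)
    = - \int[leb2]_(x in Omega) (G x 0 i * psi x).

Definition is_wdiv (eta : vector_field) (f : scalar_field) : Prop :=
  in_L1loc f /\
  forall psi, test_function psi ->
    \int[leb2]_(x in Omega) mxdot (eta x) (grad psi x)
    = - \int[leb2]_(x in Omega) (f x * psi x).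

(* Weak gradient and divergence are unique almost everywhere when they exist;
   one representative is selected. *)
Definition wgrad (w : scalar_field) : vector_field :=
  xget (fun=> 0) [set G | is_wgrad w G].

Definition wdiv (eta : vector_field) : scalar_field :=
  xget (fun=> 0) [set f | is_wdiv eta f].

Definition wdiv_rows (tau : tensor_field) : vector_field :=
  fun x => \row_(i < 2) wdiv (fun y => row i (tau y)) x.

Definition in_H1 (w : scalar_field) : Prop :=
  [/\ in_Lp 2%:E w, is_wgrad w (wgrad w) & in_Lp_mx 2%:E (wgrad w)].

Definition H1_norm (w : scalar_field) : R :=
  Num.sqrt (Lp_norm 2 w ^+ 2 + Lp_norm_mx 2 (wgrad w) ^+ 2).

(* H^{1+s}(Omega) for 0 < s < 1. *)
Definition in_H1s (s : R) (w : scalar_field) : Prop :=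
  in_H1 w /\ in_Wsp_mx s 2 (wgrad w).

Definition H1s_norm (s : R) (w : scalar_field) : R :=
  Num.sqrt (H1_norm w ^+ 2 + fine (slob_mx s 2 (wgrad w))).

End Fields.

Section Boundary.
Context {R : realType}.
Variables (Omega : set (R * R)) (m : nat) (E : 'I_m -> (R * R) * (R * R)).

Definition edge_point (i : 'I_m) (t : R) : R * R :=
  (1 - t) *: (E i).1 + t *: (E i).2.

Definition edge (i : 'I_m) : set (R * R) := edge_point i @` `[0, 1].

Definition is_endpoint (v : R * R) (i : 'I_m) : bool :=
  (v == (E i).1) || (v == (E i).2).

(* The boundary of Omega is a finite disjoint union of simple closed polygonal
   lines with edges [edge i]: this is a (possibly multiply connected) Lipschitz
   polygon, without slits or pinched vertices. *)
Record polygonal_domain : Prop := {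
  poly_open : open Omega ;
  poly_connected : connected Omega ;
  poly_bounded : bounded_set Omega ;
  poly_nonempty : Omega !=set0 ;
  poly_boundary : closure Omega `\` Omega° = \bigcup_i edge i ;
  poly_nondegenerate : forall i, (E i).1 != (E i).2 ;
  poly_edges_meet : forall i j, i != j -> forall x, edge i x -> edge j x ->
    is_endpoint x i && is_endpoint x j ;
  poly_closed : forall i v, is_endpoint v i -> #|[pred j | is_endpoint v j]| = 2%N
}.

Definition arc_integral (f : R * R -> R) : \bar R :=
  (\sum_(i < m) (euclid ((E i).2 - (E i).1))%:E *
     \int[lebesgue_measure]_(t in `[0%R, 1%R]) (f (edge_point i t))%:E)%E.

Definition arc_ae (P : R * R -> Prop) : Prop :=
  forall i, {ae lebesgue_measure, forall t : R,
    `[0, 1]%classic t -> P (edge_point i t)}.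

(* [gam] is the trace on the boundary of [w] in H^1(Omega): the limit in
   L^2(Gamma) of the restrictions of smooth functions converging to [w] in
   H^1(Omega). *)
Definition is_trace (w gam : scalar_field) : Prop :=
  [/\ in_H1 Omega w,
      (forall i, measurable_fun (`[0, 1] : set R) (gam \o edge_point i)) &
      exists v : nat -> scalar_field,
        [/\ forall n, smooth (v n),
            (fun n => H1_norm Omega (fun x => v n x - w x)) @ \oo --> (0 : R) &
            (fun n => arc_integral (fun x => (v n x - gam x) ^+ 2)) @ \oo
              --> (0 : \bar R)]].

Definition has_trace_on (S : set (R * R)) (w phi : scalar_field) : Prop :=
  exists2 gam, is_trace w gam & arc_ae (fun x => S x -> gam x = phi x).

(* Green's formula defines the pairing of the normal trace of [eta] with the
   boundary values of [w]. *)
Definition normal_pairing (eta : vector_field) (w : scalar_field) : R :=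
  \int[leb2]_(x in Omega) mxdot (eta x) (wgrad Omega w x)
  + \int[leb2]_(x in Omega) (w x * wdiv Omega eta x).

Definition normal_trace_zero_on (S : set (R * R)) (eta : vector_field) : Prop :=
  forall w, has_trace_on (\bigcup_i edge i `\` S) w (fun=> 0) ->
    normal_pairing eta w = 0.

(* H^{1/2}(S) and H^{1/2+s}(S), S a part of the boundary, are the spaces of
   traces on S of H^1(Omega) and H^{1+s}(Omega), with the quotient norms. *)
Definition in_Hhalf (S : set (R * R)) (phi : scalar_field) : Prop :=
  exists w, in_H1 Omega w /\ has_trace_on S w phi.

Definition Hhalf_norm (S : set (R * R)) (phi : scalar_field) : R :=
  inf [set H1_norm Omega w | w in
        [set w | in_H1 Omega w /\ has_trace_on S w phi]].

Definition in_Hhalfs (s : R) (S : set (R * R)) (phi : scalar_field) : Prop :=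
  exists w, in_H1s Omega s w /\ has_trace_on S w phi.

Definition Hhalfs_norm (s : R) (S : set (R * R)) (phi : scalar_field) : R :=
  inf [set H1s_norm Omega s w | w in
        [set w | in_H1s Omega s w /\ has_trace_on S w phi]].

End Boundary.

(* [visc], [cond], [grav] and [bdry] are mu, kappa, g and phi_D. The unit normal
   is not part of the data: normal traces are only used weakly, through
   [normal_pairing]. *)
Record boussinesq_data (R : realType) := BoussinesqData {
  dom : set (R * R) ;
  nedges : nat ;
  edges : 'I_nedges -> (R * R) * (R * R) ;
  GammaD : set (R * R) ;
  GammaN : set (R * R) ;
  visc : R -> R ;
  cond : R -> R ;
  grav : R * R -> 'rV[R]_2 ;
  bdry : R * R -> R
}.
Arguments edges {R} b _.

Section Problem.
Context {R : realType}.
Variable d : boussinesq_data R.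

Local Notation Omega := (dom d).
Local Notation scalar := (@scalar_field R).
Local Notation vector := (@vector_field R).
Local Notation tensor := (@tensor_field R).

Definition in_XS (tau : tensor) : Prop :=
  [/\ in_Lp_mx Omega 2%:E tau,
      forall i, let eta x := row i (tau x) in is_wdiv Omega eta (wdiv Omega eta),
      in_Lp_mx Omega (6 / 5)%:E (wdiv_rows Omega tau) &
      \int[leb2]_(x in Omega) \tr (tau x) = 0].

Definition XS_norm (tau : tensor) : R :=
  Lp_norm_mx Omega 2 tau + Lp_norm_mx Omega (6 / 5) (wdiv_rows Omega tau).

Definition in_XT (eta : vector) : Prop :=
  [/\ in_Lp_mx Omega 2%:E eta,
      is_wdiv Omega eta (wdiv Omega eta),
      in_Lp Omega (6 / 5)%:E (wdiv Omega eta) &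
      normal_trace_zero_on Omega (edges d) (GammaN d) eta].

Definition XT_norm (eta : vector) : R :=
  Lp_norm_mx Omega 2 eta + Lp_norm Omega (6 / 5) (wdiv Omega eta).

Definition in_Yv (z : vector) : Prop := in_Lp_mx Omega 6%:E z.
Definition Yv_norm (z : vector) : R := Lp_norm_mx Omega 6 z.

Definition in_Y (phi : scalar) : Prop := in_Lp Omega 6%:E phi.
Definition Y_norm (phi : scalar) : R := Lp_norm Omega 6 phi.

Definition in_Z (v : vector * tensor) : Prop :=
  [/\ in_Yv v.1, in_Lp_mx Omega 2%:E v.2 &
      ae_eq_on Omega (fun x => v.2 x + (v.2 x)^T) (fun=> 0)].

Definition Z_norm (v : vector * tensor) : R :=
  Yv_norm v.1 + Lp_norm_mx Omega 2 v.2.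

Definition in_S (s : tensor * (vector * tensor)) : Prop := in_XS s.1 /\ in_Z s.2.
Definition S_norm (s : tensor * (vector * tensor)) : R := XS_norm s.1 + Z_norm s.2.

Definition in_T (t : vector * scalar) : Prop := in_XT t.1 /\ in_Y t.2.
Definition T_norm (t : vector * scalar) : R := XT_norm t.1 + Y_norm t.2.

Definition S_eq (s s' : tensor * (vector * tensor)) : Prop :=
  [/\ ae_eq_on Omega s.1 s'.1, ae_eq_on Omega s.2.1 s'.2.1 &
      ae_eq_on Omega s.2.2 s'.2.2].

Definition VS_eq (t t' : vector * scalar) : Prop :=
  ae_eq_on Omega t.1 t'.1 /\ ae_eq_on Omega t.2 t'.2.

Definition AS (phi : scalar) (zeta tau : tensor) : R :=
  \int[leb2]_(x in Omega)
    ((visc d (phi x))^-1 * mxdot (dev (zeta x)) (dev (tau x))).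

Definition OS (phi : scalar) (z w : vector) (tau : tensor) : R :=
  \int[leb2]_(x in Omega)
    ((visc d (phi x))^-1 * mxdot (dev ((z x)^T *m w x)) (tau x)).

Definition BS (tau : tensor) (v : vector * tensor) : R :=
  \int[leb2]_(x in Omega) mxdot (v.1 x) (wdiv_rows Omega tau x)
  + \int[leb2]_(x in Omega) mxdot (v.2 x) (tau x).

Definition FS (phi : scalar) (v : vector * tensor) : R :=
  - \int[leb2]_(x in Omega) (phi x * mxdot (grav d x) (v.1 x)).

Definition AT (phi : scalar) (xi eta : vector) : R :=
  \int[leb2]_(x in Omega) ((cond d (phi x))^-1 * mxdot (xi x) (eta x)).

Definition OT (phi : scalar) (z : vector) (om : scalar) (eta : vector) : R :=
  \int[leb2]_(x in Omega)
    ((cond d (phi x))^-1 * (om x * mxdot (z x) (eta x))).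

Definition BT (eta : vector) (psi : scalar) : R :=
  \int[leb2]_(x in Omega) (psi x * wdiv Omega eta x).

(* The pairing of the normal trace of [eta] with [phiD] on GammaD, through a
   lifting of [phiD]; it does not depend on the lifting for [eta] in X, whose
   normal trace vanishes on GammaN. *)
Definition FT (phiD : scalar) (eta : vector) : R :=
  normal_pairing Omega eta
    (xget (fun=> 0)
       [set w | has_trace_on Omega (edges d) (GammaD d) w phiD]).

Definition solution_P (s : tensor * (vector * tensor)) (t : vector * scalar)
    : Prop :=
  let: (sigma, (u, _)) := s in
  let: (rho, phi) := t in
  in_S s /\ in_T t /\
  [/\ forall tau, in_XS tau -> AS phi sigma tau + OS phi u u tau + BS tau s.2 = 0,
      forall v, in_Z v -> BS sigma v = FS phi v,
      forall eta, in_XT eta ->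
        AT phi rho eta + OT phi u phi eta + BT eta phi = FT (bdry d) eta &
      forall psi, in_Y psi -> BT rho psi = 0].

Definition solution_S (z : vector) (phi : scalar)
    (s : tensor * (vector * tensor)) : Prop :=
  in_S s /\
  [/\ forall tau, in_XS tau ->
        AS phi s.1 tau + OS phi z s.2.1 tau + BS tau s.2 = 0 &
      forall v, in_Z v -> BS s.1 v = FS phi v].

Definition solution_T (z : vector) (phi : scalar) (t : vector * scalar) : Prop :=
  in_T t /\
  [/\ forall eta, in_XT eta ->
        AT phi t.1 eta + OT phi z t.2 eta + BT eta t.2 = FT (bdry d) eta &
      forall psi, in_Y psi -> BT t.1 psi = 0].

Definition S_zero : tensor * (vector * tensor) := (fun=> 0, (fun=> 0, fun=> 0)).

Definition VS_zero : vector * scalar := (fun=> 0, fun=> 0).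

Definition LS (z : vector) (phi : scalar) : tensor * (vector * tensor) :=
  xget S_zero [set s | solution_S z phi s].

Definition LT (z : vector) (phi : scalar) : vector * scalar :=
  xget VS_zero [set t | solution_T z phi t].

Definition L (p : vector * scalar) : vector * scalar :=
  ((LS p.1 (LT p.1 p.2).2).2.1, (LT p.1 p.2).2).

Definition inf_sup_S (phi : scalar) (alpha : R) : Prop :=
  forall s, in_S s ->
    ((alpha * S_norm s)%:E <=
     ereal_sup [set ((AS phi s.1 s'.1 + BS s'.1 s.2 + BS s.1 s'.2)
                       / S_norm s')%:E
               | s' in [set s' | in_S s' /\ ~ S_eq s' S_zero]])%E.

Definition inf_sup_T (phi : scalar) (alpha : R) : Prop :=
  forall t, in_T t ->
    ((alpha * T_norm t)%:E <=
     ereal_sup [set ((AT phi t.1 t'.1 + BT t'.1 t.2 + BT t.1 t'.2)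
                       / T_norm t')%:E
               | t' in [set t' | in_T t' /\ ~ VS_eq t' VS_zero]])%E.

Definition W_norm (p : vector * scalar) : R := Yv_norm p.1 + Y_norm p.2.

Definition W_ball (r : R) (p : vector * scalar) : Prop :=
  [/\ in_Yv p.1, in_Y p.2 & W_norm p <= r].

Definition W_sub (p q : vector * scalar) : vector * scalar :=
  (fun x => p.1 x - q.1 x, fun x => p.2 x - q.2 x).

End Problem.

(* Main.v *)
Require Import Defs.
From HB Require Import structures.
From mathcomp Require Import all_boot all_order all_algebra.
From mathcomp Require Import all_classical all_reals all_analysis.
From mathcomp Require Import measurable_realfun.
From mathcomp Require Import ess_sup_inf.
From mathcomp Require Import ring lra.
Set Implicit Arguments.
Unset Strict Implicit.
Unset Printing Implicit Defensive.
Import Order.TTheory GRing.Theory Num.Theory.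
Import numFieldNormedType.Exports.
Local Open Scope classical_set_scope.
Local Open Scope ring_scope.

(* The inf-sup conditions bound the solutions of the two decoupled problems: the
   convective terms are controlled by Hoelder's inequality with exponents 6, 6, 6
   and 2, and the radii are such that they absorb half of the inf-sup constants.
   Hence L maps the ball W(R) into itself, and under the second smallness
   assumption it is a contraction there. Banach's theorem applies because L^6 is
   complete: along the iterates the increments decay geometrically, so that they
   are almost everywhere absolutely summable, and Fatou's lemma identifies the
   limit. Fixed points of L and solutions of the coupled problem correspond
   because all the forms are insensitive to almost everywhere modifications of
   their arguments. *)

(** * Integrals of possibly non-measurable functions *)

(** Elements of the spaces are functions, not classes, and [LS] and [LT] are selected by [xget]
    among solutions that are unique only up to null sets. Every identity of the argument, the
    fixed-point equation included, therefore holds almost everywhere only, and Banach's iteration is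
    run on representatives with [VS_eq] in place of equality. The integrands of the forms multiply
    coefficients such as [(visc d (phi x))^-1] with fields known to be measurable only once
    restricted to the domain. To avoid tracking measurability through these products, the integrals
    of the forms are handled by monotonicity alone, and the linearity of the forms is never invoked:
    the inf-sup condition is applied to a whole solution, whose equations rewrite the numerator as
    the source term minus the convective term. *)

Section LowerIntegral.
Local Open Scope ereal_scope.
Context d (T : measurableType d) (R : realType).
Variable mu : {measure set T -> \bar R}.
Import HBNNSimple.

(* The integral of a nonnegative function is a supremum over the simple
   functions below it, so no measurability is needed: a simple function below
   [f] is below [g] once it is killed on a null set. *)
Lemma ge0_ae_le_integral (f g : T -> \bar R) :
  (forall x, 0 <= f x) -> (forall x, 0 <= g x) ->
  {ae mu, forall x, f x <= g x} -> \int[mu]_x f x <= \int[mu]_x g x.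
Proof.
move=> f0 g0 [N [mN muN0 fgN]].
rewrite (ge0_integralTE _ f0) (ge0_integralTE _ g0).
apply: ge_ereal_sup => _ [h /= hf <-].
have mNC : measurable (~` N) by exact: measurableC.
pose h' : {nnsfun T >-> R} := proj_nnsfun h mNC.
have -> : sintegral mu h = sintegral mu h'.
  rewrite -!integralT_nnsfun; apply: ge0_ae_eq_integral => //.
  - exact/measurable_EFinP.
  - exact/measurable_EFinP.
  - by move=> x _; rewrite lee_fin.
  - by move=> x _; rewrite lee_fin.
  - exists N; split=> // x /= hx; apply: contrapT => Nx; apply: hx => _.
    by rewrite /h' /= /mindic indicE mem_set// mulr1.
apply: ereal_sup_ubound; exists h' => // x /=.
rewrite /mindic indicE; have [|] := boolP (x \in ~` N); last by rewrite mulr0.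
rewrite inE mulr1 => Nx; apply: le_trans (hf x) _.
by apply: contrapT => /fgN.
Qed.

Lemma ge0_ae_le_integral_in (D : set T) (f g : T -> \bar R) :
  (forall x, D x -> 0 <= f x) -> (forall x, D x -> 0 <= g x) ->
  {ae mu, forall x, D x -> f x <= g x} ->
  \int[mu]_(x in D) f x <= \int[mu]_(x in D) g x.
Proof.
move=> f0 g0 fg; rewrite integral_mkcond [leRHS]integral_mkcond.
apply: ge0_ae_le_integral => [x|x|]; [exact: erestrict_ge0..|].
apply: filterS fg => x fgx; rewrite /patch; case: ifPn => //.
by rewrite inE => /fgx.
Qed.

(** An integral is the difference of the lower integrals of the positive and negative parts, and
    these agree by monotonicity in both directions. This is what lets the forms accept arbitrary
    almost everywhere modifications. *)
Lemma ae_eq_lower_integral (D : set T) (f g : T -> \bar R) :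
  ae_eq mu D f g -> \int[mu]_(x in D) f x = \int[mu]_(x in D) g x.
Proof.
move=> /ae_eq_funeposneg[fgp fgn]; rewrite integralE [RHS]integralE.
congr (_ - _); apply/eqP; rewrite eq_le; apply/andP; split;
  apply: ge0_ae_le_integral_in => //.
- by apply: filterS fgp => x /[apply] ->.
- by apply: filterS fgp => x /[apply] ->.
- by apply: filterS fgn => x /[apply] ->.
- by apply: filterS fgn => x /[apply] ->.
Qed.

Lemma ae_eq_Rintegral (D : set T) (f g : T -> R) :
  ae_eq mu D f g -> (\int[mu]_(x in D) f x = \int[mu]_(x in D) g x)%R.
Proof.
move=> fg; congr fine; apply: ae_eq_lower_integral.
by apply: filterS fg => x /[apply] ->.
Qed.

(** The lower integrals of the two parts of [f] both lie between 0 and the finite integral of [g],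
    so their difference is at most that integral in absolute value, even for a non-measurable
    [f]. *)
Lemma ler_norm_Rintegral (D : set T) (f g : T -> R) :
  (forall x, D x -> (`|f x| <= g x)%R) ->
  \int[mu]_(x in D) (g x)%:E < +oo ->
  (`|\int[mu]_(x in D) f x| <= \int[mu]_(x in D) g x)%R.
Proof.
move=> fg goo.
have g0 x : D x -> (0 <= g x)%R by move/fg; exact: le_trans.
rewrite /Rintegral integralE.
set A := \int[mu]_(x in D) _; set B := \int[mu]_(x in D) _.
set G := \int[mu]_(x in D) _ in goo *.
have A0 : 0 <= A by apply: integral_ge0.
have B0 : 0 <= B by apply: integral_ge0.
have G0 : 0 <= G by apply: integral_ge0 => x /g0; rewrite lee_fin.
have AG : A <= G.
  apply: ge0_ae_le_integral_in => //; apply: aeW => x Dx.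
  rewrite funeposE -EFin_max lee_fin ge_max g0// andbT.
  by apply: le_trans (fg _ Dx); rewrite ler_norm.
have BG : B <= G.
  apply: ge0_ae_le_integral_in => //; apply: aeW => x Dx.
  rewrite funenegE -EFinN -EFin_max lee_fin ge_max g0// andbT.
  by apply: le_trans (fg _ Dx); rewrite -normrN ler_norm.
have Gf : G \is a fin_num by rewrite ge0_fin_numE.
have Af : A \is a fin_num by rewrite ge0_fin_numE// (le_lt_trans AG).
have Bf : B \is a fin_num by rewrite ge0_fin_numE// (le_lt_trans BG).
move: A0 B0 AG BG; rewrite -(fineK Af) -(fineK Bf) -(fineK Gf) !lee_fin /=.
move=> A0 B0 AG BG; rewrite ler_norml; apply/andP; split.
  by rewrite lerNl opprB lerBlDl (le_trans BG)// lerDr.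
by rewrite lerBlDl (le_trans AG)// lerDr.
Qed.

End LowerIntegral.

(** * Hoelder's inequality and completeness of Lp *)

Section LnormFacts.
Local Open Scope ereal_scope.
Context d (T : measurableType d) (R : realType).
Variable mu : {measure set T -> \bar R}.
Local Notation "'N_ p [ f ]" := (Lnorm mu p (EFin \o f)).
Implicit Types (f g : T -> R) (p q r : R).

Lemma measurable_norm_powR f p : measurable_fun setT f ->
  measurable_fun setT (fun x => `|f x| `^ p)%R.
Proof.
move=> mf; apply: (@measurableT_comp _ _ _ _ _ _ (@powR R ^~ p)) => //.
exact: measurableT_comp.
Qed.

Lemma le_ae_Lnorm p f g : (0 < p)%R ->
  {ae mu, forall x, (`|f x| <= `|g x|)%R} -> 'N_p%:E[f] <= 'N_p%:E[g].
Proof.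
move=> p0 fg; rewrite unlock; apply: gt0_ler_poweR.
- by rewrite invr_ge0 ltW.
- by rewrite in_itv /= leey integral_ge0// => x _; rewrite poweR_ge0.
- by rewrite in_itv /= leey integral_ge0// => x _; rewrite poweR_ge0.
apply: ge0_ae_le_integral => [x|x|]; [exact: poweR_ge0..|].
apply: filterS fg => x fgx /=; rewrite lee_fin.
by apply: ge0_ler_powR; rewrite ?nnegrE ?(ltW p0).
Qed.

Lemma Lnorm_norm_powR f p r : (0 < p)%R -> (0 < r)%R ->
  'N_(p / r)%:E[(fun x => `|f x| `^ r)%R] = 'N_p%:E[f] `^ r.
Proof.
move=> p0 r0; rewrite unlock /= -poweRrM invf_div (mulrC r); congr (_ `^ _).
apply: eq_integral => x _; rewrite /= ger0_norm ?powR_ge0//.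
by rewrite -powRrM mulrCA divff ?mulr1// gt_eqF.
Qed.

(** The usual inequality is applied to [|f|^r] and [|g|^r] with the conjugate exponents [p / r] and
    [q / r]; an r-th root is then taken. *)
Lemma generalized_hoelder f g p q r :
  measurable_fun setT f -> measurable_fun setT g ->
  (0 < p)%R -> (0 < q)%R -> (0 < r)%R -> (p^-1 + q^-1 = r^-1)%R ->
  'N_r%:E[(f \* g)%R] <= 'N_p%:E[f] * 'N_q%:E[g].
Proof.
move=> mf mg p0 q0 r0 pqr.
have le_r : 'N_r%:E[(f \* g)%R] `^ r <= ('N_p%:E[f] * 'N_q%:E[g]) `^ r.
  rewrite poweRM ?Lnorm_ge0// -!Lnorm_norm_powR// divff ?gt_eqF//.
  apply: le_trans (hoelder _ _ _ _ _ _) => //.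
  - rewrite le_eqVlt; apply/orP; left; apply/eqP; apply: eq_Lnorm => x /=.
    by rewrite normrM powRM.
  - exact: measurable_norm_powR.
  - exact: measurable_norm_powR.
  - exact: divr_gt0.
  - exact: divr_gt0.
  - by rewrite !invf_div -mulrDr pqr divff// gt_eqF.
have := @gt0_ler_poweR R r^-1 (ltW _) _ _ _ _ le_r.
rewrite -!poweRrM divff ?gt_eqF// !poweRe1 ?mule_ge0 ?Lnorm_ge0//.
by apply; rewrite ?invr_gt0// in_itv /= leey poweR_ge0.
Qed.

End LnormFacts.

(** * Limits in L^p of sequences with geometrically decaying increments *)

Section LpCompleteness.
Context d (T : measurableType d) (R : realType).
Variable mu : {measure set T -> \bar R}.
Local Notation "'N_ p [ f ]" := (Lnorm mu p (EFin \o f)).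
Implicit Types (f g : T -> R) (p c k C : R).

Lemma Lnorm_le_integral f p C : 0 < p -> 0 <= C ->
  ('N_p%:E[f] <= C%:E)%E <-> (\int[mu]_x (`|f x| `^ p)%:E <= (C `^ p)%:E)%E.
Proof.
move=> p0 C0; have -> : (\int[mu]_x (`|f x| `^ p)%:E = 'N_p%:E[f] `^ p)%E.
  by rewrite powR_Lnorm ?gt_eqF.
rewrite -poweR_EFin; split => h.
  apply: gt0_ler_poweR => //; first exact: ltW.
  - by rewrite in_itv /= leey Lnorm_ge0.
  - by rewrite in_itv /= leey andbT lee_fin.
have : (('N_p%:E[f] `^ p) `^ p^-1 <= (C%:E `^ p) `^ p^-1)%E.
  apply: gt0_ler_poweR => //.
  - by rewrite invr_ge0 ltW.
  - by rewrite in_itv /= leey poweR_ge0.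
  - by rewrite in_itv /= leey lee_fin powR_ge0.
by rewrite -!poweRrM divff ?gt_eqF// !poweRe1 ?Lnorm_ge0 ?lee_fin.
Qed.

(** Serves twice below: on the partial sums of the absolute increments, to get their convergence
    almost everywhere, and on the differences with later terms, to get the rate of convergence. *)
Lemma Lnorm_fatou (h : nat -> T -> R) p C : 0 < p -> 0 <= C ->
  (forall n, measurable_fun setT (h n)) ->
  (forall n, 'N_p%:E[h n] <= C%:E)%E ->
  (\int[mu]_x limn_einf (fun n => (`|h n x| `^ p)%:E) <= (C `^ p)%:E)%E.
Proof.
move=> p0 C0 mh hC.
apply: (le_trans (fatou mu measurableT _ _)) => [n|n x _|].
- exact/measurable_EFinP/measurable_norm_powR.
- by rewrite lee_fin powR_ge0.
rewrite limn_einf_lim; apply: lime_le; first exact: is_cvg_einfs.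
apply: nearW => n; apply: le_trans (ereal_inf_lbound _) _.
  by exists n => /=; [exact: leqnn|reflexivity].
exact/(Lnorm_le_integral _ p0 C0).
Qed.

Lemma Lnorm_geometric_sum (h : nat -> T -> R) p c k : 1 <= p -> 0 <= c ->
  0 <= k < 1 -> (forall n, measurable_fun setT (h n)) ->
  (forall n, 'N_p%:E[h n] <= (c * k ^+ n)%:E)%E ->
  forall n, ('N_p%:E[(fun x => \sum_(i < n) h i x)%R] <= (c / (1 - k))%:E)%E.
Proof.
move=> p1 c0 /andP[k0 k1] mh hk n.
have k1' : 0 < 1 - k by rewrite subr_gt0.
have p0 : 0 < p by rewrite (lt_le_trans ltr01).
have mS j : measurable_fun setT (fun x => \sum_(i < j) h i x).
  exact: measurable_sum.
(* The induction needs the exact value of the finite geometric sum; the bound by the full series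
   does not reproduce itself. *)
apply: (@le_trans _ _ (c / (1 - k) * (1 - k ^+ n))%:E); last first.
  by rewrite lee_fin ler_piMr ?divr_ge0 ?(ltW k1')// gerBl exprn_ge0.
elim: n => [|n IH].
  rewrite expr0 subrr mulr0; under eq_Lnorm do rewrite /= big_ord0.
  by rewrite Lnorm0// eqe gt_eqF.
under eq_Lnorm do rewrite /= big_ord_recr /=.
apply: le_trans (minkowski_EFin _ (mS n) (mh n) p1) _.
apply: le_trans (leeD IH (hk n)) _.
rewrite -EFinD lee_fin le_eqVlt; apply/orP; left; apply/eqP.
by rewrite exprSr; field; rewrite gt_eqF.
Qed.

Lemma ae_lt_pinfty (F : T -> \bar R) : measurable_fun setT F ->
  (forall x, 0 <= F x)%E -> (\int[mu]_x F x < +oo)%E ->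
  {ae mu, forall x, (F x < +oo)%E}.
Proof.
move=> mF F0 Foo; have /integrable_ae : mu.-integrable setT F.
  apply/integrableP; split => //.
  by under eq_integral do rewrite gee0_abs//.
move=> /(_ measurableT); apply: filterS => x /(_ I).
by rewrite ge0_fin_numE.
Qed.

Lemma cvg_powR (u : nat -> R) (l p : R) : 0 < p -> (forall n, 0 <= u n) ->
  u @ \oo --> l -> u n `^ p @[n --> \oo] --> l `^ p.
Proof.
move=> p0 u0 ul; have l0 : 0 <= l.
  rewrite -(cvg_lim _ ul)//; apply: limr_ge.
    by apply/cvg_ex; exists l.
  exact: nearW.
move: l0; rewrite le_eqVlt => /predU1P[l0|l0].
  rewrite -l0 powR0 ?gt_eqF// in ul *.
  apply/cvgr0Pnorm_lt => e e0.
  have [N _ uN] := (cvgr0Pnorm_lt _).1 ul (e `^ p^-1) (powR_gt0 _ e0).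
  exists N => // n Nn; have := uN n Nn; rewrite /= !ger0_norm ?powR_ge0//.
  move=> /(@gt0_ltr_powR R p p0) => /(_ (u0 n) (powR_ge0 _ _)).
  by rewrite -powRrM mulVf ?gt_eqF// powRr1// ltW.
apply: (@cvg_comp _ _ _ u (@powR R ^~ p)); first exact: ul.
suff : {for l, continuous (@powR R ^~ p)} by [].
apply: differentiable_continuous; apply/derivable1_diffP.
by apply: derivable_powR; rewrite in_itv /= l0.
Qed.

Lemma Lp_geometric_limit (f : nat -> T -> R) p c k : 1 <= p -> 0 <= c ->
  0 <= k < 1 -> (forall n, f n \in Lfun mu p%:E) ->
  (forall n, 'N_p%:E[(f n.+1 \- f n)%R] <= (c * k ^+ n)%:E)%E ->
  exists2 g, g \in Lfun mu p%:E &
    forall n, ('N_p%:E[(f n \- g)%R] <= (c * k ^+ n / (1 - k))%:E)%E.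
Proof.
move=> p1 c0 k01 fLp fk; have /andP[k0 k1] := k01.
have p0 : 0 < p by rewrite (lt_le_trans ltr01).
have k1' : 0 < 1 - k by rewrite subr_gt0.
have mf n : measurable_fun setT (f n).
  by have := fLp n; rewrite inE => /andP[/[!inE]/= mf _].
pose D n x := f n.+1 x - f n x.
have mD n : measurable_fun setT (D n) by exact: measurable_funB.
have mnD n : measurable_fun setT (fun x => `|D n x|) by exact: measurableT_comp.
have nDk n : ('N_p%:E[(fun x => `|D n x|)%R] <= (c * k ^+ n)%:E)%E.
  have -> : 'N_p%:E[(fun x => `|D n x|)%R] = 'N_p%:E[D n]; last exact: fk.
  by rewrite -[RHS]Lnorm_abse; apply: eq_Lnorm.
pose S n x : R := \sum_(i < n) `|D i x|.
have Sk n : ('N_p%:E[S n] <= (c / (1 - k))%:E)%E.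
  exact: (Lnorm_geometric_sum p1 c0 k01 mnD nDk).
have mS n : measurable_fun setT (S n) by exact: measurable_sum.
have S_fin : {ae mu, forall x,
    (limn_einf (fun n => (`|S n x| `^ p)%:E) < +oo)%E}.
  apply: ae_lt_pinfty => [|x|].
  (* Measurability of the lower limit is obtained from that of an upper limit by a double change of
     sign. *)
  - rewrite (_ : (fun x => _) = \- (fun x =>
        limn_esup (fun n => - (`|S n x| `^ p)%:E))%E)%E.
      apply: measurableT_comp => //; apply: measurable_fun_limn_esup => n.
      apply: measurableT_comp => //.
      exact/measurable_EFinP/measurable_norm_powR.
    apply/funext => x /=.
    by rewrite (limn_esupN (fun n => (`|S n x| `^ p)%:E)) oppeK.
  - rewrite limn_einf_lim; apply: lime_ge; first exact: is_cvg_einfs.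
    apply: nearW => n; apply: le_ereal_inf_tmp => _ [m _ <-].
    by rewrite lee_fin powR_ge0.
  - apply: le_lt_trans (Lnorm_fatou p0 _ mS Sk) (ltry _).
    by rewrite divr_ge0// ltW.
have f_cvg : {ae mu, forall x, cvgn (f ^~ x)}.
  apply: filterS S_fin => x.
  have S_ge0 n : 0 <= S n x by apply: sumr_ge0.
  have S_nd : nondecreasing_seq (S ^~ x).
    apply/nondecreasing_seqP => n; rewrite /S big_ord_recr /= lerDl//.
  have Sp_nd : nondecreasing_seq (fun n => (`|S n x| `^ p)%:E).
    move=> m n mn; rewrite lee_fin !ger0_norm//.
    by apply: ge0_ler_powR; rewrite ?nnegrE ?(ltW p0)//; exact: S_nd.
  have Sp_cvg := ereal_nondecreasing_is_cvgn Sp_nd.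
  rewrite (is_cvg_limn_einfE Sp_cvg) => Sp_fin.
  set L := limn _ in Sp_fin.
  have SpL n : ((`|S n x| `^ p)%:E <= L)%E.
    rewrite /L (cvg_lim _ (ereal_nondecreasing_cvgn Sp_nd))//.
    by apply: ereal_sup_ubound; exists n.
  have Lfin : L \is a fin_num.
    rewrite ge0_fin_numE//; apply: le_trans (SpL 0%N).
    by rewrite lee_fin powR_ge0.
  have S_bnd n : S n x <= fine L `^ p^-1.
    have := SpL n; rewrite -(fineK Lfin) lee_fin ger0_norm// => SL.
    rewrite -[leLHS]powRr1// -(divff (lt0r_neq0 p0)) powRrM.
    apply: ge0_ler_powR; rewrite ?nnegrE ?invr_ge0 ?powR_ge0 ?(ltW p0)//.
    exact: le_trans (powR_ge0 _ _) SL.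
  have S_cvg : cvgn (S ^~ x).
    by apply: nondecreasing_is_cvgn => //; exists (fine L `^ p^-1) => _ [n _ <-].
  (* The series of increments converges absolutely, and its partial sums are [f n x - f 0 x]. *)
  have : cvgn (series (telescope (f ^~ x))).
    apply: normed_cvg; rewrite (_ : [normed series _] = S ^~ x)//.
    by apply/funext => n; rewrite /S -(big_mkord xpredT (fun i => `|D i x|)).
  rewrite telescopeK => fx.
  have -> : f ^~ x = (fun n => f n x - f 0%N x) \+ cst (f 0%N x).
    by apply/funext => n /=; rewrite subrK.
  by apply: is_cvgD => //; exact: is_cvg_cst.
(* An upper limit exists at every point and is measurable, so the limit is defined without first
   removing the null set of divergence. *)
pose g x := fine (limn_esup (fun n => (f n x)%:E)).
have mg : measurable_fun setT g.
  apply: measurableT_comp; first exact: fine_measurable.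
  apply: (measurable_fun_limn_esup (f := fun n x => (f n x)%:E)) => n.
  exact/measurable_EFinP.
have fg : {ae mu, forall x, f ^~ x @ \oo --> g x}.
  apply: filterS f_cvg => x /cvg_ex[/= l fl].
  have fle : (f n x)%:E @[n --> \oo] --> l%:E.
    by apply: cvg_EFin => //; exact: nearW.
  by rewrite /g (cvg_limn_einf_sup fle).
have fgk n : ('N_p%:E[(f n \- g)%R] <= (c * k ^+ n / (1 - k))%:E)%E.
  have C0 : 0 <= c * k ^+ n / (1 - k).
    by rewrite divr_ge0 ?mulr_ge0 ?exprn_ge0// ltW.
  apply/Lnorm_le_integral => //.
  (* With [n] fixed, Fatou's lemma in [m] passes from the differences [f n - f (n + m)] to
     [f n - g]. *)
  apply: le_trans (Lnorm_fatou (h := fun m => f n \- f (n + m)%N) p0 C0 _ _).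
  - apply: ge0_ae_le_integral => [x|x|].
    + by rewrite lee_fin powR_ge0.
    + rewrite limn_einf_lim; apply: lime_ge; first exact: is_cvg_einfs.
      apply: nearW => m; apply: le_ereal_inf_tmp => _ [j _ <-].
      by rewrite lee_fin powR_ge0.
    + apply: filterS fg => x fgx.
      rewrite le_eqVlt; apply/orP; left; apply/eqP/esym.
      apply: (cvg_limn_einf_sup _).1; apply: cvg_EFin; first exact: nearW.
      apply: (@cvg_powR (fun m => `|f n x - f (n + m)%N x|)) => //.
      apply: cvg_norm; apply: cvgB; first exact: cvg_cst.
      by apply: (@cvg_comp _ _ _ (addn n) (f ^~ x)) fgx; exact: cvg_addnl.
  - by move=> m; exact: measurable_funB.
  - move=> m.
    (* Up to sign this is a sum of increments starting at [n], hence geometric with [c * k ^+ n] in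
       place of [c]. *)
    have -> : (f n \- f (n + m)%N) = \- (fun x => \sum_(i < m) D (n + i)%N x).
      apply/funext => x /=; elim: m => [|m IH].
        by rewrite addn0 subrr big_ord0 oppr0.
      by rewrite big_ord_recr /= opprD -IH /D addnS; lra.
    rewrite (oppe_Lnorm _ (EFin \o (fun x => \sum_(i < m) D (n + i)%N x))).
    apply: (Lnorm_geometric_sum (h := fun i => D (n + i)%N) p1 _ k01) => // [|i].
      by rewrite mulr_ge0// exprn_ge0.
    by rewrite -mulrA -exprD; exact: fk.
exists g => //.
have -> : g = f 0%N + - (f 0%N \- g).
  by apply/funext => x; rewrite fctE/= opprB addrC subrK.
have p1' : (1 <= p%:E)%E by rewrite lee_fin.
apply: (Lfun_addr_closed mu p1').2; first exact: fLp.
apply: Lfun_oppr_closed; rewrite inE; apply/andP; split; rewrite inE /=.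
  exact: measurable_funB.
exact: le_lt_trans (fgk 0%N) (ltry _).
Qed.

End LpCompleteness.

(** * The plane *)

Section Plane.
Context {R : realType}.

(** The plane carries the product sigma-algebra, so an open set has to be exhibited as a countable
    union of rectangles: those with rational endpoints contained in it. *)
Lemma open_measurable_plane (A : set (R * R)) : open A ->
  measurable (A : set (measurableTypeR R * measurableTypeR R)).
Proof.
move=> oA.
pose rect (q : (rat * rat) * (rat * rat)) :
    set (measurableTypeR R * measurableTypeR R) :=
  [set` `]ratr q.1.1, (ratr q.1.2 : R)[] `*`
  [set` `]ratr q.2.1, (ratr q.2.2 : R)[].
pose F q := if `[< rect q `<=` A >] then rect q else set0.
have -> : A = \bigcup_q F q.
  apply/seteqP; split => [x Ax|x [q _]]; last first.
    by rewrite /F; case: asboolP => [rA /rA|].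
  have /nbhs_ballP[e /= e0 eA] : nbhs x A by apply: open_nbhs_nbhs.
  have rat_near (y : R) : exists q : rat * rat,
      ratr q.1 < y < ratr q.2 /\ y - e < ratr q.1 /\ ratr q.2 < y + e.
    have /rat_in_itvoo[a] : y - e < y by rewrite ltrBlDr ltrDl.
    have /rat_in_itvoo[b] : y < y + e by rewrite ltrDl.
    rewrite !in_itv /= => /andP[h1 h2] /andP[h3 h4].
    by exists (a, b) => /=; rewrite h1 h4.
  have [q1 [/andP[q1l q1r] [q1e q1e']]] := rat_near x.1.
  have [q2 [/andP[q2l q2r] [q2e q2e']]] := rat_near x.2.
  exists (q1, q2) => //; rewrite /F; case: asboolP => [_|[]].
    by split; rewrite /= in_itv /= ?q1l ?q1r ?q2l ?q2r.
  move=> y [/=]; rewrite !in_itv /= => /andP[y1 y1'] /andP[y2 y2']; apply: eA.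
  by split; rewrite /ball /= ltr_distl; apply/andP; split; lra.
apply: countable_bigcupT_measurable => // q; rewrite /F; case: asboolP => // _.
by apply: measurableX; exact: measurable_itv.
Qed.

Lemma bounded_leb2_lty (A : set (R * R)) : bounded_set A ->
  measurable (A : set (measurableTypeR R * measurableTypeR R)) ->
  (leb2 A < +oo)%E.
Proof.
move=> [M [Mreal bA]] mA.
have {bA} bA x : A x -> `|x| <= M + 1 by apply: bA; rewrite ltrDl.
pose I : set (measurableTypeR R) := [set` `[- (M + 1), M + 1]].
have mI : measurable I by exact: measurable_itv.
apply: (@le_lt_trans _ _ (leb2 (I `*` I))).
  apply: le_measure; rewrite ?inE//; first exact: measurableX.
  move=> x /bA; rewrite prod_normE ge_max => /andP[].
  by rewrite !ler_norml; split => /=; rewrite /I /= in_itv.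
have -> : leb2 (I `*` I) = (lebesgue_measure I * lebesgue_measure I)%E.
  exact: product_measure1E.
apply: lte_mul_pinfty => //.
- have -> := lebesgue_measure_itv `[- (M + 1), M + 1]; case: ifP => // _.
- have -> := lebesgue_measure_itv `[- (M + 1), M + 1].
  by case: ifP => // _; rewrite ltry.
Qed.

End Plane.

(** * The Frobenius product and norm *)

Section Frobenius.
Context {R : realType}.

Lemma mxdot_ge0 m n (A : 'M[R]_(m, n)) : 0 <= mxdot A A.
Proof. by apply: sumr_ge0 => i _; apply: sumr_ge0 => j _; exact: sqr_ge0. Qed.

Lemma frob_ge0 m n (A : 'M[R]_(m, n)) : 0 <= frob A.
Proof. exact: sqrtr_ge0. Qed.

Lemma sqr_frob m n (A : 'M[R]_(m, n)) : frob A ^+ 2 = mxdot A A.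
Proof. by rewrite sqr_sqrtr// mxdot_ge0. Qed.

Lemma mxdotDl m n (A B C : 'M[R]_(m, n)) : mxdot (A + B) C = mxdot A C + mxdot B C.
Proof.
rewrite /mxdot -big_split; apply: eq_bigr => i _; rewrite -big_split.
by apply: eq_bigr => j _; rewrite mxE mulrDl.
Qed.

Lemma mxdotZl m n a (A C : 'M[R]_(m, n)) : mxdot (a *: A) C = a * mxdot A C.
Proof.
rewrite /mxdot mulr_sumr; apply: eq_bigr => i _; rewrite mulr_sumr.
by apply: eq_bigr => j _; rewrite mxE mulrA.
Qed.

Lemma mxdotC m n (A B : 'M[R]_(m, n)) : mxdot A B = mxdot B A.
Proof. by apply: eq_bigr => i _; apply: eq_bigr => j _; rewrite mulrC. Qed.

Lemma mxdotDr m n (A B C : 'M[R]_(m, n)) : mxdot A (B + C) = mxdot A B + mxdot A C.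
Proof. by rewrite mxdotC mxdotDl !(mxdotC _ A). Qed.

Lemma mxdotZr m n a (A C : 'M[R]_(m, n)) : mxdot A (a *: C) = a * mxdot A C.
Proof. by rewrite mxdotC mxdotZl mxdotC. Qed.

Lemma frob0 m n : frob (0 : 'M[R]_(m, n)) = 0.
Proof. by rewrite /frob -(scale0r 0) mxdotZl mul0r sqrtr0. Qed.

Lemma frobN m n (A : 'M[R]_(m, n)) : frob (- A) = frob A.
Proof. by rewrite /frob -scaleN1r mxdotZl mxdotZr mulN1r mulN1r opprK. Qed.

Lemma frob_eq0 m n (A : 'M[R]_(m, n)) : frob A = 0 -> A = 0.
Proof.
move=> A0; have /eqP : mxdot A A = 0 by rewrite -sqr_frob A0 expr0n.
rewrite psumr_eq0 => [/allP h|i _]; last first.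
  by apply: sumr_ge0 => j _; exact: sqr_ge0.
apply/matrixP => i j; have := h i; rewrite mem_index_enum => /(_ isT) /=.
rewrite psumr_eq0 => [/allP /(_ j)|k _]; last exact: sqr_ge0.
by rewrite mem_index_enum => /(_ isT) /=; rewrite mulf_eq0 orbb mxE => /eqP.
Qed.

Lemma mxdot_le_frob m n (A B : 'M[R]_(m, n)) : `|mxdot A B| <= frob A * frob B.
Proof.
have [B0|B0] := eqVneq (frob B) 0.
  by rewrite (frob_eq0 B0) -(scale0r 0) mxdotZr mul0r normr0 scale0r frob0 mulr0.
have Bp : 0 < frob B by rewrite lt_def B0 frob_ge0.
rewrite -(@ler_pXn2r _ 2)// ?nnegrE ?mulr_ge0 ?frob_ge0//.
rewrite real_normK ?num_real// exprMn !sqr_frob.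
have bp : 0 < mxdot B B by rewrite -sqr_frob exprn_gt0.
(* With [a = A:A], [b = B:B] and [c = A:B], the square of [b A - c B] equals [b (a b - c^2)], which
   is Cauchy-Schwarz after division by [b]. *)
have := mxdot_ge0 (mxdot B B *: A + (- mxdot A B) *: B).
rewrite !(mxdotDl, mxdotDr, mxdotZl, mxdotZr) (mxdotC B A).
set a := mxdot A A; set b := mxdot B B in bp *; set c := mxdot A B => h.
rewrite -subr_ge0 -(pmulr_rge0 _ bp).
by apply: le_trans h _; rewrite le_eqVlt; apply/orP; left; apply/eqP; ring.
Qed.

Lemma ler_frobD m n (A B : 'M[R]_(m, n)) : frob (A + B) <= frob A + frob B.
Proof.
rewrite -(@ler_pXn2r _ 2)// ?nnegrE ?addr_ge0 ?frob_ge0//.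
rewrite sqr_frob sqrrD !sqr_frob !(mxdotDl, mxdotDr) (mxdotC B A).
have := le_trans (ler_norm _) (mxdot_le_frob A B); lra.
Qed.

Lemma ler_norm_frob m n (A : 'M[R]_(m, n)) i j : `|A i j| <= frob A.
Proof.
rewrite -(@ler_pXn2r _ 2)// ?nnegrE ?frob_ge0// sqr_frob real_normK ?num_real//.
rewrite /mxdot (bigD1 i)//= (bigD1 j)//= -expr2 -addrA lerDl addr_ge0//.
  by apply: sumr_ge0 => l _; exact: sqr_ge0.
by apply: sumr_ge0 => l _; apply: sumr_ge0 => k _; exact: sqr_ge0.
Qed.

(** With [ler_norm_frob], this makes convergence of a matrix field in the norm of its Frobenius
    length equivalent to entrywise convergence. *)
Lemma ler_frob_sum m n (A : 'M[R]_(m, n)) : frob A <= \sum_i \sum_j `|A i j|.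
Proof.
have sum_ge0 (I : finType) (F : I -> R) : (forall i, 0 <= F i) ->
    \sum_i F i ^+ 2 <= (\sum_i F i) ^+ 2.
  move=> F0; rewrite expr2 mulr_suml; apply: ler_sum => i _; rewrite expr2.
  by rewrite ler_wpM2l// (bigD1 i)//= lerDl sumr_ge0.
rewrite -(@ler_pXn2r _ 2)// ?nnegrE ?frob_ge0// ?sumr_ge0// => [|i _]; last first.
  exact: sumr_ge0.
rewrite sqr_frob; apply: le_trans (sum_ge0 _ _ _) => [|i]; last exact: sumr_ge0.
apply: ler_sum => i _; apply: le_trans (sum_ge0 _ _ _) => //.
by apply: ler_sum => j _; rewrite real_normK ?num_real// expr2.
Qed.

Lemma frob_dev (A : 'M[R]_2) : frob (dev A) <= frob A.
Proof.
rewrite -(@ler_pXn2r _ 2)// ?nnegrE ?frob_ge0// !sqr_frob /mxdot /dev.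
rewrite /mxtrace !big_ord_recl !big_ord0 !mxE /= !mulr1n !mulr0n.
rewrite -subr_ge0; set x := A _ _; set y := A _ _; set z := A _ _; set w := A _ _.
(* Passing to the deviator lowers the squared norm by half the squared trace, and [x + w] is the
   trace. *)
have := sqr_ge0 (x + w); nra.
Qed.

Lemma frob_tensor (z w : 'rV[R]_2) : frob (z^T *m w) = frob z * frob w.
Proof.
apply/eqP; rewrite -(@eqrXn2 _ 2)// ?mulr_ge0 ?frob_ge0//; apply/eqP.
rewrite exprMn !sqr_frob /mxdot !big_ord_recl !big_ord0 !mxE.
by rewrite !big_ord_recl !big_ord0 !mxE; ring.
Qed.

End Frobenius.

(** * Lebesgue norms on a subset of the plane *)

(* The library's hint for this fact does not see through the elaboration of the
   type of [leb2]. *)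
#[global] Instance leb2_nbhs_ae_filter (R : realType) :
  Filter (nbhs (almost_everywhere (@leb2 R))).
Proof. exact: (ae_filter_ringOfSetsType (@leb2 R)). Qed.

Section LpOmega.
Context {R : realType}.
Variable Omega : set (R * R).
Hypothesis mOmega :
  measurable (Omega : set (measurableTypeR R * measurableTypeR R)).
Local Notation "'N_ p [ f ]" := (Lnorm leb2 p (EFin \o f)).
Implicit Types (f g h : @scalar_field R) (p : R).

Local Notation plane := (measurableTypeR R * measurableTypeR R)%type.

Lemma in_Lp_measurable q f : in_Lp Omega q f ->
  measurable_fun setT (f \_ Omega : plane -> R).
Proof. by rewrite /in_Lp inE => /andP[/[!inE]]. Qed.

Lemma in_Lp_lty q f : in_Lp Omega q f -> ('N_q[f \_ Omega] < +oo)%E.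
Proof. by rewrite /in_Lp inE => /andP[_ /[!inE]]. Qed.

Lemma in_LpI q f : measurable_fun setT (f \_ Omega : plane -> R) ->
  ('N_q[f \_ Omega] < +oo)%E -> in_Lp Omega q f.
Proof. by move=> mf fq; rewrite /in_Lp inE; apply/andP; split; rewrite inE. Qed.

Lemma Lp_normK p f : in_Lp Omega p%:E f ->
  (Lp_norm Omega p f)%:E = 'N_p%:E[f \_ Omega].
Proof. by move=> fp; rewrite fineK// ge0_fin_numE ?Lnorm_ge0// in_Lp_lty. Qed.

Lemma Lp_norm_ge0 p f : 0 <= Lp_norm Omega p f.
Proof. by rewrite fine_ge0// Lnorm_ge0. Qed.

Lemma le_ae_Lnorm_on p f g : 0 < p ->
  {ae leb2, forall x, Omega x -> `|f x| <= `|g x|} ->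
  ('N_p%:E[f \_ Omega] <= 'N_p%:E[g \_ Omega])%E.
Proof.
move=> p0 fg; apply: le_ae_Lnorm => //; apply: filterS fg => x fgx.
by rewrite /patch; case: ifPn => // /set_mem /fgx.
Qed.

Lemma in_Lp_ae_le p f g : 0 < p -> in_Lp Omega p%:E g ->
  measurable_fun setT (f \_ Omega : plane -> R) ->
  {ae leb2, forall x, Omega x -> `|f x| <= `|g x|} -> in_Lp Omega p%:E f.
Proof.
move=> p0 gp mf fg; apply: in_LpI => //.
by apply: le_lt_trans (le_ae_Lnorm_on p0 fg) _; exact: in_Lp_lty.
Qed.

Lemma Lp_norm_ae_le p f g : 0 < p -> in_Lp Omega p%:E g ->
  {ae leb2, forall x, Omega x -> `|f x| <= `|g x|} ->
  Lp_norm Omega p f <= Lp_norm Omega p g.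
Proof.
move=> p0 gp fg; have fgN := le_ae_Lnorm_on p0 fg.
have := le_lt_trans fgN (in_Lp_lty gp) => foo.
by rewrite fine_le// ge0_fin_numE ?Lnorm_ge0// in_Lp_lty.
Qed.

Lemma Lp_norm_le p f g : 0 < p -> in_Lp Omega p%:E g ->
  (forall x, Omega x -> `|f x| <= `|g x|) ->
  Lp_norm Omega p f <= Lp_norm Omega p g.
Proof. by move=> p0 gp fg; apply: Lp_norm_ae_le => //; exact: aeW. Qed.

Lemma Lp_norm_ae_eq p f g : 0 < p -> ae_eq_on Omega f g ->
  Lp_norm Omega p f = Lp_norm Omega p g.
Proof.
move=> p0 fg; congr fine; apply/eqP; rewrite eq_le; apply/andP; split.
  by apply: le_ae_Lnorm_on => //; apply: filterS fg => x /[apply] ->.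
by apply: le_ae_Lnorm_on => //; apply: filterS fg => x /[apply] ->.
Qed.

Lemma patchD f g : (fun x => f x + g x) \_ Omega = f \_ Omega \+ g \_ Omega.
Proof. by apply/funext => x; rewrite /patch /=; case: ifP; rewrite ?addr0. Qed.

Lemma in_LpD p f g : 1 <= p -> in_Lp Omega p%:E f -> in_Lp Omega p%:E g ->
  in_Lp Omega p%:E (fun x => f x + g x).
Proof.
move=> p1 fp gp; rewrite /in_Lp patchD.
have p1' : (1 <= p%:E)%E by rewrite lee_fin.
exact: (Lfun_addr_closed leb2 p1').2.
Qed.

Lemma in_LpN p f : in_Lp Omega p%:E f -> in_Lp Omega p%:E (fun x => - f x).
Proof.
rewrite /in_Lp => fp; have -> : (fun x => - f x) \_ Omega = - (f \_ Omega).
  by apply/funext => x; rewrite /patch fctE /=; case: ifP; rewrite ?oppr0.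
exact: Lfun_oppr_closed.
Qed.

Lemma in_LpB p f g : 1 <= p -> in_Lp Omega p%:E f -> in_Lp Omega p%:E g ->
  in_Lp Omega p%:E (fun x => f x - g x).
Proof. by move=> p1 fp /in_LpN; exact: in_LpD. Qed.

Lemma in_Lp_sum (I : finType) p (F : I -> @scalar_field R) : 1 <= p ->
  (forall i, in_Lp Omega p%:E (F i)) ->
  in_Lp Omega p%:E (fun x => \sum_i F i x).
Proof.
move=> p1 Fp; have p1' : (1 <= p%:E)%E by rewrite lee_fin.
rewrite (_ : (fun _ => _) = \sum_i F i); last first.
  by apply/funext => x; rewrite fct_sumE.
elim/big_ind: _ => [|f g fp gp|i _]; last exact: Fp.
  rewrite /in_Lp (_ : 0 \_ Omega = 0); first exact: (Lfun_addr_closed leb2 p1').1.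
  by apply/funext => x; rewrite /patch; case: ifP.
exact: in_LpD.
Qed.

Lemma Lp_normD p f g : 1 <= p -> in_Lp Omega p%:E f -> in_Lp Omega p%:E g ->
  Lp_norm Omega p (fun x => f x + g x) <= Lp_norm Omega p f + Lp_norm Omega p g.
Proof.
move=> p1 fp gp; rewrite -lee_fin EFinD !Lp_normK//; last exact: in_LpD.
by rewrite patchD; apply: minkowski_EFin => //;
  [exact: in_Lp_measurable fp|exact: in_Lp_measurable gp].
Qed.

Lemma Lp_norm_subC p f g :
  Lp_norm Omega p (fun x => f x - g x) = Lp_norm Omega p (fun x => g x - f x).
Proof.
congr fine; rewrite -[LHS]Lnorm_abse -[RHS]Lnorm_abse; apply: eq_Lnorm => x /=.
by rewrite /patch; case: ifP => // _; rewrite distrC.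
Qed.

Lemma Lp_norm_triangle p f g h : 1 <= p ->
  in_Lp Omega p%:E f -> in_Lp Omega p%:E g -> in_Lp Omega p%:E h ->
  Lp_norm Omega p (fun x => f x - h x) <=
  Lp_norm Omega p (fun x => f x - g x) + Lp_norm Omega p (fun x => g x - h x).
Proof.
move=> p1 fp gp hp; have fgp := in_LpB p1 fp gp; have ghp := in_LpB p1 gp hp.
apply: le_trans (Lp_normD p1 fgp ghp).
by under [in leRHS]eq_fun do rewrite addrA subrK.
Qed.

Lemma in_Lp_norm p f : in_Lp Omega p%:E f -> in_Lp Omega p%:E (fun x => `|f x|).
Proof.
move=> fp; have E : (fun x => `|f x|) \_ Omega = (fun x => `|(f \_ Omega) x|).
  by apply/funext => x; rewrite /patch; case: ifP; rewrite ?normr0.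
apply: in_LpI; rewrite E.
  apply: (measurableT_comp (@normr_measurable R setT)).
  exact: in_Lp_measurable fp.
rewrite (_ : 'N_p%:E[_] = 'N_p%:E[f \_ Omega]); first exact: in_Lp_lty.
by rewrite -[RHS]Lnorm_abse; apply: eq_Lnorm.
Qed.

Lemma Lp_norm_norm p f : Lp_norm Omega p (fun x => `|f x|) = Lp_norm Omega p f.
Proof.
congr fine; rewrite -[RHS]Lnorm_abse; apply: eq_Lnorm => x /=.
by rewrite /patch; case: ifP; rewrite ?normr0.
Qed.

Lemma Lp_norm_sum (I : finType) p (F : I -> @scalar_field R) : 1 <= p ->
  (forall i, in_Lp Omega p%:E (F i)) ->
  Lp_norm Omega p (fun x => \sum_i F i x) <= \sum_i Lp_norm Omega p (F i).
Proof.
move=> p1 Fp; have p0 : 0 < p by rewrite (lt_le_trans ltr01).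
suff H (s : seq I) : in_Lp Omega p%:E (fun x => \sum_(i <- s) F i x) /\
    Lp_norm Omega p (fun x => \sum_(i <- s) F i x)
    <= \sum_(i <- s) Lp_norm Omega p (F i) by exact: (H _).2.
elim: s => [|i s [IHp IH]].
  have E : (fun x => \sum_(i <- [::]) F i x) \_ Omega = cst 0.
    by apply/funext => x; rewrite /patch big_nil; case: ifP.
  rewrite /in_Lp /Lp_norm E big_nil Lnorm0 ?eqe ?gt_eqF//; split=> //.
  have p1' : (1 <= p%:E)%E by rewrite lee_fin.
  exact: (Lfun_addr_closed leb2 p1').1.
under [X in in_Lp _ _ X]eq_fun do rewrite big_cons.
under [X in Lp_norm _ _ X]eq_fun do rewrite big_cons.
rewrite big_cons; split; first exact: in_LpD.
by apply: le_trans (Lp_normD p1 (Fp i) IHp) _; rewrite lerD2l.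
Qed.

Lemma Lp_norm_eq0 p f : 0 < p -> in_Lp Omega p%:E f -> Lp_norm Omega p f = 0 ->
  ae_eq_on Omega f (fun=> 0).
Proof.
move=> p0 fp f0; have N0 : 'N_p%:E[f \_ Omega] = 0%E by rewrite -Lp_normK// f0.
have mf : measurable_fun setT (EFin \o (f \_ Omega) : plane -> \bar R).
  by apply/measurable_EFinP; exact: in_Lp_measurable fp.
have p0' : (0 < p%:E)%E by rewrite lte_fin.
have := Lnorm_eq0_eq0 mf p0' N0; apply: filterS => x /(_ I) /= + Ox.
by rewrite patchT ?inE// => -[].
Qed.

Lemma Lnorm_cst_restrict p (c : R) : 0 < p ->
  'N_p%:E[(fun=> c) \_ Omega] = (((`|c| `^ p)%:E * leb2 Omega) `^ p^-1)%E.
Proof.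
move=> p0; rewrite unlock; congr (_ `^ _)%E.
rewrite -integral_cst// [RHS]integral_mkcond; apply: eq_integral => x _ /=.
by rewrite /patch; case: ifP => //=; rewrite normr0 powR0 ?gt_eqF.
Qed.

Lemma in_Lp_cst p (c : R) : 0 < p -> (leb2 Omega < +oo)%E ->
  in_Lp Omega p%:E (fun=> c).
Proof.
move=> p0 Ooo; apply: in_LpI.
  by apply: (measurable_restrictT _ mOmega).1; exact: measurable_cst.
rewrite (Lnorm_cst_restrict c p0) poweR_lty//.
by rewrite lte_mul_pinfty// lee_fin powR_ge0.
Qed.

Lemma in_Linfty_in_Lp p f : 0 < p -> (leb2 Omega < +oo)%E ->
  in_Lp Omega +oo f -> in_Lp Omega p%:E f.
Proof.
move=> p0 Ooo foo; have := in_Lp_lty foo; rewrite unlock.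
have bnd M : {ae leb2, forall x, `|(f \_ Omega) x| <= M} -> in_Lp Omega p%:E f.
  move=> fM; apply: (in_Lp_ae_le p0 (in_Lp_cst M p0 Ooo)).
    exact: in_Lp_measurable foo.
  apply: filterS fM => x + Ox; rewrite patchT ?inE// => /le_trans -> //.
  exact: ler_norm.
(* The L^oo norm is an essential supremum only if the whole space has positive measure. Otherwise it
   takes a default value, but then any bound holds almost everywhere. *)
case: ifPn => [T0 /ess_supr_bounded[M fM]|]; first by apply: (bnd M).
rewrite -leNgt => T0 _; apply: (bnd 0); apply: measure0_ae.
by apply/eqP; rewrite eq_le T0 /=; exact: measure_ge0.
Qed.

Lemma Lp_norm_geometric_limit (f : nat -> @scalar_field R) p c k :
  1 <= p -> 0 <= c -> 0 <= k < 1 -> (forall n, in_Lp Omega p%:E (f n)) ->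
  (forall n, Lp_norm Omega p (fun x => f n.+1 x - f n x) <= c * k ^+ n) ->
  exists2 g, in_Lp Omega p%:E g &
    forall n, Lp_norm Omega p (fun x => f n x - g x) <= c * k ^+ n / (1 - k).
Proof.
move=> p1 c0 k01 fp fk; have p0 : 0 < p by rewrite (lt_le_trans ltr01).
have patchB u v : (fun x => u x - v x) \_ Omega =
    u \_ Omega \- v \_ Omega :> (R * R -> R).
  by apply/funext => x; rewrite /patch /=; case: ifP; rewrite ?subrr.
have [n|n|g gp gk] := @Lp_geometric_limit _ _ _ leb2
    (fun n => f n \_ Omega) p c k p1 c0 k01.
- exact: fp.
- by rewrite -patchB -Lp_normK ?lee_fin//; exact: in_LpB.
have mg : measurable_fun setT (g : plane -> R).
  by move: gp; rewrite inE => /andP[/[!inE]].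
have goo : ('N_p%:E[g] < +oo)%E by move: gp; rewrite inE => /andP[_ /[!inE]].
(* The limit is found on the whole plane and may be nonzero off [Omega]; cutting it off there does
   not increase its norm. *)
have gO : in_Lp Omega p%:E g.
  apply: in_LpI.
    apply: (measurable_restrictT _ mOmega).1.
    exact: measurable_funS measurableT _ mg.
  apply: le_lt_trans goo; apply: le_ae_Lnorm => //; apply: aeW => x.
  by rewrite /patch; case: ifP; rewrite ?normr0.
exists g => // n; rewrite -lee_fin Lp_normK; last exact: in_LpB.
apply: le_trans (gk n); apply: le_ae_Lnorm => //; apply: aeW => x.
by rewrite /patch /=; case: ifP; rewrite ?normr0.
Qed.

End LpOmega.

(** * Matrix fields with entries in L^p *)

Section LpMatrix.
Context {R : realType}.
Variable Omega : set (R * R).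
Variables m n : nat.
Local Notation plane := (measurableTypeR R * measurableTypeR R)%type.
Implicit Types (F G : R * R -> 'M[R]_(m, n)) (p : R).

Lemma measurable_frob q F : in_Lp_mx Omega q F ->
  measurable_fun setT ((fun x => frob (F x)) \_ Omega : plane -> R).
Proof.
move=> Fq; have -> : (fun x => frob (F x)) \_ Omega =
    (fun x => Num.sqrt (\sum_i \sum_j ((fun x => F x i j) \_ Omega) x ^+ 2)).
  apply/funext => x; rewrite /patch; case: ifP => [xO|xO].
    by congr Num.sqrt; apply: eq_bigr => i _; apply: eq_bigr => j _; rewrite expr2.
  rewrite big1 ?sqrtr0// => i _; rewrite big1// => j _; exact: expr0n.
apply: (@measurableT_comp _ _ _ _ _ _ (@Num.sqrt R)).
  by apply: continuous_measurable_fun; exact: sqrt_continuous.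
apply: measurable_sum => i; apply: measurable_sum => j.
by apply: measurable_funX; exact: in_Lp_measurable (Fq i j).
Qed.

Lemma in_Lp_frob p F : 1 <= p -> in_Lp_mx Omega p%:E F ->
  in_Lp Omega p%:E (fun x => frob (F x)).
Proof.
move=> p1 Fp; apply: (@in_Lp_ae_le _ _ _ _ (fun x => \sum_i \sum_j `|F x i j|)).
- by rewrite (lt_le_trans ltr01).
- by do 2![apply: in_Lp_sum => // ?]; exact: in_Lp_norm.
- exact: measurable_frob Fp.
- apply: aeW => x _; rewrite ger0_norm ?frob_ge0//.
  by apply: le_trans (ler_frob_sum _) (ler_norm _).
Qed.

Lemma in_Lp_mxB p F G : 1 <= p -> in_Lp_mx Omega p%:E F ->
  in_Lp_mx Omega p%:E G -> in_Lp_mx Omega p%:E (fun x => F x - G x).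
Proof.
move=> p1 Fp Gp i j; rewrite (_ : (fun _ => _) = (fun x => F x i j - G x i j)).
  exact: in_LpB.
by apply/funext => x; rewrite !mxE.
Qed.

Lemma Lp_norm_mx_ge0 p F : 0 <= Lp_norm_mx Omega p F.
Proof. exact: Lp_norm_ge0. Qed.

Lemma Lp_norm_mx_ae_eq p F G : 0 < p -> ae_eq_on Omega F G ->
  Lp_norm_mx Omega p F = Lp_norm_mx Omega p G.
Proof.
move=> p0 FG; apply: Lp_norm_ae_eq => //.
by apply: filterS FG => x /[apply] ->.
Qed.

Lemma Lp_norm_mxN p F : Lp_norm_mx Omega p (fun x => - F x) = Lp_norm_mx Omega p F.
Proof. by rewrite /Lp_norm_mx; under eq_fun do rewrite frobN. Qed.

Lemma Lp_norm_mxC p F G : Lp_norm_mx Omega p (fun x => F x - G x) =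
  Lp_norm_mx Omega p (fun x => G x - F x).
Proof. by rewrite -Lp_norm_mxN; under eq_fun do rewrite opprB. Qed.

Lemma Lp_norm_mx_triangle p F G H : 1 <= p ->
  in_Lp_mx Omega p%:E F -> in_Lp_mx Omega p%:E G -> in_Lp_mx Omega p%:E H ->
  Lp_norm_mx Omega p (fun x => F x - H x) <=
  Lp_norm_mx Omega p (fun x => F x - G x) + Lp_norm_mx Omega p (fun x => G x - H x).
Proof.
move=> p1 Fp Gp Hp; have p0 : 0 < p by rewrite (lt_le_trans ltr01).
have FGp := in_Lp_frob p1 (in_Lp_mxB p1 Fp Gp).
have GHp := in_Lp_frob p1 (in_Lp_mxB p1 Gp Hp).
apply: le_trans (Lp_normD p1 FGp GHp); apply: Lp_norm_le => // [|x _].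
  exact: in_LpD.
rewrite ger0_norm ?frob_ge0// ger0_norm ?addr_ge0 ?frob_ge0//.
by apply: le_trans (ler_frobD _ _); rewrite addrA subrK.
Qed.

Lemma Lp_norm_mx_entry p F i j : 1 <= p -> in_Lp_mx Omega p%:E F ->
  Lp_norm Omega p (fun x => F x i j) <= Lp_norm_mx Omega p F.
Proof.
move=> p1 Fp; apply: Lp_norm_le => [||x _]; first by rewrite (lt_le_trans ltr01).
  exact: in_Lp_frob.
by rewrite (ger0_norm (frob_ge0 _)) ler_norm_frob.
Qed.

Lemma Lp_norm_mx_sum p F : 1 <= p -> in_Lp_mx Omega p%:E F ->
  Lp_norm_mx Omega p F <= \sum_i \sum_j Lp_norm Omega p (fun x => F x i j).
Proof.
move=> p1 Fp; have p0 : 0 < p by rewrite (lt_le_trans ltr01).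
have Sp i : in_Lp Omega p%:E (fun x => \sum_j `|F x i j|).
  by apply: in_Lp_sum => // j; exact: in_Lp_norm.
apply: (@le_trans _ _ (Lp_norm Omega p (fun x => \sum_i \sum_j `|F x i j|))).
  apply: Lp_norm_le => // [|x _]; first exact: in_Lp_sum.
  rewrite ger0_norm ?frob_ge0//.
  by apply: le_trans (ler_frob_sum _) (ler_norm _).
apply: le_trans (Lp_norm_sum p1 Sp) _; apply: ler_sum => i _.
apply: le_trans (Lp_norm_sum p1 (fun j => in_Lp_norm (Fp i j))) _.
by apply: ler_sum => j _; rewrite Lp_norm_norm.
Qed.

Lemma Lp_norm_mx_eq0 p F : 1 <= p -> in_Lp_mx Omega p%:E F ->
  Lp_norm_mx Omega p F = 0 -> ae_eq_on Omega F (fun=> 0).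
Proof.
move=> p1 Fp F0; have p0 : 0 < p by rewrite (lt_le_trans ltr01).
have := Lp_norm_eq0 p0 (in_Lp_frob p1 Fp) F0.
by apply: filterS => x /[apply]; exact: frob_eq0.
Qed.

Hypothesis mOmega : measurable (Omega : set plane).

(** Each entry has increments dominated by those of the field and so has a scalar limit; choice
    assembles these limits, and [C] adds up the errors of all the entries. *)
Lemma Lp_mx_geometric_limit (F : nat -> R * R -> 'M[R]_(m, n)) p c k :
  1 <= p -> 0 <= c -> 0 <= k < 1 -> (forall l, in_Lp_mx Omega p%:E (F l)) ->
  (forall l, Lp_norm_mx Omega p (fun x => F l.+1 x - F l x) <= c * k ^+ l) ->
  exists2 G, in_Lp_mx Omega p%:E G & exists2 C, 0 <= C &
    forall l, Lp_norm_mx Omega p (fun x => F l x - G x) <= C * k ^+ l.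
Proof.
move=> p1 c0 k01 Fp Fk; have /andP[k0 k1] := k01.
have entry i j : exists2 g, in_Lp Omega p%:E g &
    forall l, Lp_norm Omega p (fun x => F l x i j - g x) <= c * k ^+ l / (1 - k).
  apply: Lp_norm_geometric_limit => // l; first exact: Fp.
  apply: le_trans (Fk l); have Dp := in_Lp_mxB p1 (Fp l.+1) (Fp l).
  apply: le_trans (Lp_norm_mx_entry i j p1 Dp).
  by under [in leRHS]eq_fun do rewrite !mxE.
have /choice[G GP] : forall ij : 'I_m * 'I_n, exists g, in_Lp Omega p%:E g /\
    forall l, Lp_norm Omega p (fun x => F l x ij.1 ij.2 - g x)
              <= c * k ^+ l / (1 - k).
  by move=> ij; have [g gp gk] := entry ij.1 ij.2; exists g.
have GLp : in_Lp_mx Omega p%:E (fun x => \matrix_(i, j) G (i, j) x).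
  move=> i j; rewrite (_ : (fun _ => _) = G (i, j)); first exact: (GP (i, j)).1.
  by apply/funext => x; rewrite mxE.
exists (fun x => \matrix_(i, j) G (i, j) x) => //.
exists (\sum_(i < m) \sum_(j < n) c / (1 - k)).
  do 2![apply: sumr_ge0 => ? _]; rewrite divr_ge0// subr_ge0; exact: ltW.
move=> l; apply: le_trans (Lp_norm_mx_sum p1 (in_Lp_mxB p1 (Fp l) GLp)) _.
rewrite mulr_suml; apply: ler_sum => i _.
rewrite mulr_suml; apply: ler_sum => j _; rewrite mulrAC.
apply: le_trans ((GP (i, j)).2 l).
by under [X in Lp_norm _ _ X]eq_fun do rewrite !mxE.
Qed.

End LpMatrix.

(** * Bounds on integrals of products over a domain of finite measure *)

Section MultilinearBounds.
Context {R : realType}.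
Variable Omega : set (R * R).
Hypothesis mOmega :
  measurable (Omega : set (measurableTypeR R * measurableTypeR R)).
Hypothesis Omega_lty : (leb2 Omega < +oo)%E.
Local Notation "'N_ p [ f ]" := (Lnorm leb2 p (EFin \o f)).
Implicit Types (f g h : @scalar_field R) (p : R).

Lemma ler_norm_Rintegral_Lnorm h f (B : R) :
  (forall x, Omega x -> `|h x| <= f x) -> ('N_1[f \_ Omega] <= B%:E)%E ->
  `|\int[leb2]_(x in Omega) h x| <= B.
Proof.
move=> hf fB; have f0 x : Omega x -> 0 <= f x by move/hf; exact: le_trans.
have fE : (\int[leb2]_(x in Omega) (f x)%:E = 'N_1[f \_ Omega])%E.
  rewrite Lnorm1 [LHS]integral_mkcond; apply: eq_integral => x _ /=.
  rewrite /patch; case: ifPn => [/set_mem /f0 fx0|_]; last by rewrite normr0.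
  by rewrite ger0_norm.
have foo : (\int[leb2]_(x in Omega) (f x)%:E < +oo)%E.
  by rewrite fE (le_lt_trans fB)// ltry.
apply: le_trans (@ler_norm_Rintegral _ _ _ leb2 _ _ _ hf foo) _.
by rewrite -lee_fin /Rintegral fineK ?fE// -fE ge0_fin_numE// fE Lnorm_ge0.
Qed.

Lemma patchM f g : (fun x => f x * g x) \_ Omega = (f \_ Omega) \* (g \_ Omega).
Proof. by apply/funext => x; rewrite /patch /=; case: ifP; rewrite ?mulr0. Qed.

Lemma in_LpM p q r f g : 0 < p -> 0 < q -> 0 < r -> p^-1 + q^-1 = r^-1 ->
  in_Lp Omega p%:E f -> in_Lp Omega q%:E g ->
  in_Lp Omega r%:E (fun x => f x * g x).
Proof.
move=> p0 q0 r0 pqr fp gq; have mf := in_Lp_measurable fp.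
have mg := in_Lp_measurable gq; apply: in_LpI; rewrite patchM.
  exact: measurable_funM.
apply: le_lt_trans (@generalized_hoelder _ _ _ leb2 _ _ _ _ _ mf mg p0 q0 r0 pqr) _.
by rewrite -!Lp_normK// ltry.
Qed.

Lemma Lp_normM p q r f g : 0 < p -> 0 < q -> 0 < r -> p^-1 + q^-1 = r^-1 ->
  in_Lp Omega p%:E f -> in_Lp Omega q%:E g ->
  Lp_norm Omega r (fun x => f x * g x) <= Lp_norm Omega p f * Lp_norm Omega q g.
Proof.
move=> p0 q0 r0 pqr fp gq; have mf := in_Lp_measurable fp.
have mg := in_Lp_measurable gq.
rewrite -lee_fin EFinM !Lp_normK//; last exact: (in_LpM p0 q0 r0 pqr).
rewrite patchM.
exact: (@generalized_hoelder _ _ _ leb2 _ _ _ _ _ mf mg p0 q0 r0 pqr).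
Qed.

Lemma Lp_norm_cst p (c : R) : 0 < p -> 0 <= c ->
  Lp_norm Omega p (fun=> c) = c * fine (leb2 Omega) `^ p^-1.
Proof.
move=> p0 c0; rewrite /Lp_norm (Lnorm_cst_restrict mOmega c p0) ger0_norm//.
have Ofin : leb2 Omega \is a fin_num by rewrite ge0_fin_numE.
rewrite -(fineK Ofin) -EFinM poweR_EFin /= powRM ?powR_ge0 ?fine_ge0//.
by rewrite -powRrM divff ?powRr1// gt_eqF.
Qed.

(* Hoelder with exponents 6, 6, 6 and 2, the constant being one of the factors. *)
Lemma ler_Rintegral_6_6_2 (c : R) z w t h : 0 <= c ->
  in_Lp Omega 6%:E z -> in_Lp Omega 6%:E w -> in_Lp Omega 2%:E t ->
  (forall x, Omega x -> `|h x| <= c * z x * w x * t x) ->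
  `|\int[leb2]_(x in Omega) h x| <=
  c * fine (leb2 Omega) `^ 6^-1
  * Lp_norm Omega 6 z * Lp_norm Omega 6 w * Lp_norm Omega 2 t.
Proof.
move=> c0 z6 w6 t2 hle.
have c6 : in_Lp Omega 6%:E (fun=> c) by apply: in_Lp_cst.
have cz3 : in_Lp Omega 3%:E (fun x => c * z x).
  by apply: (in_LpM (p := 6) (q := 6)) => //; lra.
have czw2 : in_Lp Omega 2%:E (fun x => c * z x * w x).
  by apply: (in_LpM (p := 3) (q := 6)) => //; lra.
have czwt1 : in_Lp Omega 1%:E (fun x => c * z x * w x * t x).
  by apply: (in_LpM (p := 2) (q := 2)) => //; lra.
apply: ler_norm_Rintegral_Lnorm hle _; rewrite -Lp_normK// lee_fin.
apply: le_trans (Lp_normM (p := 2) (q := 2) _ _ _ _ czw2 t2) _; rewrite ?invr1//.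
  by lra.
rewrite ler_wpM2r ?Lp_norm_ge0//.
apply: le_trans (Lp_normM (p := 3) (q := 6) _ _ _ _ cz3 w6) _ => //; first by lra.
rewrite ler_wpM2r ?Lp_norm_ge0//.
apply: le_trans (Lp_normM (p := 6) (q := 6) _ _ _ _ c6 z6) _ => //; first by lra.
by rewrite Lp_norm_cst.
Qed.

(** Two factors in L^6 have their product in L^3, whose conjugate exponent is 3/2; this is where the
    norm of the gravity field in the smallness conditions comes from. *)
Lemma ler_Rintegral_6_32_6 f g v h :
  in_Lp Omega 6%:E f -> in_Lp Omega (3 / 2)%:E g -> in_Lp Omega 6%:E v ->
  (forall x, Omega x -> `|h x| <= f x * v x * g x) ->
  `|\int[leb2]_(x in Omega) h x| <=
  Lp_norm Omega 6 f * Lp_norm Omega 6 v * Lp_norm Omega (3 / 2) g.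
Proof.
move=> f6 g32 v6 hle.
have fv3 : in_Lp Omega 3%:E (fun x => f x * v x).
  by apply: (in_LpM (p := 6) (q := 6)) => //; lra.
have fvg1 : in_Lp Omega 1%:E (fun x => f x * v x * g x).
  by apply: (in_LpM (p := 3) (q := 3 / 2)) => //; lra.
apply: ler_norm_Rintegral_Lnorm hle _; rewrite -Lp_normK// lee_fin.
apply: le_trans (Lp_normM (p := 3) (q := 3 / 2) _ _ _ _ fv3 g32) _;
  rewrite ?invr1//.
  by lra.
rewrite ler_wpM2r ?Lp_norm_ge0//.
by apply: (Lp_normM (p := 6) (q := 6)) => //; lra.
Qed.

End MultilinearBounds.

(** * The forms of the Boussinesq system and a priori bounds *)

Section Forms.
Context {R : realType}.
Variable d : boussinesq_data R.
Local Notation Omega := (dom d).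

Lemma eq_ae_Rintegral (f g : @scalar_field R) : ae_eq_on Omega f g ->
  \int[leb2]_(x in Omega) f x = \int[leb2]_(x in Omega) g x.
Proof. exact: (@ae_eq_Rintegral _ _ _ leb2). Qed.

Lemma eq_ae_AS phi phi' zeta tau : ae_eq_on Omega phi phi' ->
  AS d phi zeta tau = AS d phi' zeta tau.
Proof.
by move=> e; apply: eq_ae_Rintegral; apply: filterS e => x /[apply] ->.
Qed.

Lemma eq_ae_OS phi phi' z z' w w' tau : ae_eq_on Omega phi phi' ->
  ae_eq_on Omega z z' -> ae_eq_on Omega w w' ->
  OS d phi z w tau = OS d phi' z' w' tau.
Proof.
move=> e1 e2 e3; apply: eq_ae_Rintegral; apply: filterS3 e1 e2 e3 => x.
by move=> h1 h2 h3 Ox; rewrite h1// h2// h3.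
Qed.

Lemma eq_ae_BS tau v v' gam : ae_eq_on Omega v v' ->
  BS d tau (v, gam) = BS d tau (v', gam).
Proof.
move=> e; congr (_ + _); apply: eq_ae_Rintegral.
by apply: filterS e => x /[apply] /= ->.
Qed.

Lemma eq_ae_FS phi phi' v : ae_eq_on Omega phi phi' -> FS d phi v = FS d phi' v.
Proof.
move=> e; congr (- _); apply: eq_ae_Rintegral.
by apply: filterS e => x /[apply] ->.
Qed.

Lemma eq_ae_AT phi phi' xi eta : ae_eq_on Omega phi phi' ->
  AT d phi xi eta = AT d phi' xi eta.
Proof.
by move=> e; apply: eq_ae_Rintegral; apply: filterS e => x /[apply] ->.
Qed.

Lemma eq_ae_OT phi phi' z z' om om' eta : ae_eq_on Omega phi phi' ->
  ae_eq_on Omega z z' -> ae_eq_on Omega om om' ->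
  OT d phi z om eta = OT d phi' z' om' eta.
Proof.
move=> e1 e2 e3; apply: eq_ae_Rintegral; apply: filterS3 e1 e2 e3 => x.
by move=> h1 h2 h3 Ox; rewrite h1// h2// h3.
Qed.

Lemma eq_ae_BT eta psi psi' : ae_eq_on Omega psi psi' ->
  BT d eta psi = BT d eta psi'.
Proof.
by move=> e; apply: eq_ae_Rintegral; apply: filterS e => x /[apply] ->.
Qed.

(** Converts between the problem solved by [LS], where velocity and temperature are frozen, and the
    coupled one, where they coincide with the unknowns almost everywhere. *)
Lemma solution_S_ae z z' phi phi' sigma u u' gam : ae_eq_on Omega z z' ->
  ae_eq_on Omega phi phi' -> ae_eq_on Omega u u' -> in_Yv d u' ->
  solution_S d z phi (sigma, (u, gam)) -> solution_S d z' phi' (sigma, (u', gam)).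
Proof.
move=> ez ep eu u'Y [[sX [_ gL gsk]] [h1 h2]]; split; first by split.
split=> [tau tX|v vZ] /=; last by rewrite -(eq_ae_FS _ ep); exact: h2.
rewrite -(eq_ae_AS _ _ ep) -(eq_ae_OS _ ep ez eu) -(eq_ae_BS _ _ eu).
exact: h1.
Qed.

Lemma solution_T_ae z z' phi phi' rho psi psi' : ae_eq_on Omega z z' ->
  ae_eq_on Omega phi phi' -> ae_eq_on Omega psi psi' -> in_Y d psi' ->
  solution_T d z phi (rho, psi) -> solution_T d z' phi' (rho, psi').
Proof.
move=> ez ep es pY [[rX _] [h1 h2]]; split; first by split.
split=> [eta eX|chi cY] /=; last exact: h2.
rewrite -(eq_ae_AT _ _ ep) -(eq_ae_OT _ ep ez es) -(eq_ae_BT _ es).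
exact: h1.
Qed.

Lemma solution_PE sigma u gam rho phi :
  solution_P d (sigma, (u, gam)) (rho, phi) <->
  solution_S d u phi (sigma, (u, gam)) /\ solution_T d u phi (rho, phi).
Proof.
split=> [[sS [tT [h1 h2 h3 h4]]]|[[sS [h1 h2]] [tT [h3 h4]]]].
  by split; split.
by split.
Qed.

Lemma S_norm_ge0 s : 0 <= S_norm d s.
Proof. by rewrite !addr_ge0 ?Lp_norm_mx_ge0. Qed.

Lemma T_norm_ge0 t : 0 <= T_norm d t.
Proof. by rewrite !addr_ge0 ?Lp_norm_mx_ge0 ?Lp_norm_ge0. Qed.

Lemma ler_pM3 (a b c a' b' c' : R) : 0 <= a -> 0 <= b -> 0 <= c ->
  a <= a' -> b <= b' -> c <= c' -> a * b * c <= a' * b' * c'.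
Proof.
by move=> a0 b0 c0 aa bb cc; apply: ler_pM; rewrite ?mulr_ge0//; exact: ler_pM.
Qed.

Hypothesis mOmega :
  measurable (Omega : set (measurableTypeR R * measurableTypeR R)).
Hypothesis Omega_lty : (leb2 Omega < +oo)%E.
Local Notation c6 := (fine (leb2 Omega) `^ 6^-1).

Lemma ler_inv_bound (nu1 nu : R) : 0 < nu1 -> nu1 <= nu -> `|nu^-1| <= nu1^-1.
Proof.
move=> n1 n; have n0 : 0 < nu by exact: lt_le_trans n.
by rewrite ger0_norm ?invr_ge0 ?(ltW n0)// lef_pV2.
Qed.

(** The bound [mu1^-1] on the coefficient is the constant factor placed in L^6, whence the power
    [c6] of the area. The resulting [mu1^-1 * c6] times the radius [mu1 * alphaS / (2 * c6)] is
    [alphaS / 2]. *)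
Lemma ler_norm_OS (mu1 : R) phi z w tau : 0 < mu1 ->
  (forall t, mu1 <= visc d t) -> in_Yv d z -> in_Yv d w ->
  in_Lp_mx Omega 2%:E tau ->
  `|OS d phi z w tau| <=
  mu1^-1 * c6 * Yv_norm d z * Yv_norm d w * Lp_norm_mx Omega 2 tau.
Proof.
move=> m0 mv zY wY tL; apply: (ler_Rintegral_6_6_2 mOmega Omega_lty).
- by rewrite invr_ge0 ltW.
- by apply: in_Lp_frob => //; lra.
- by apply: in_Lp_frob => //; lra.
- by apply: in_Lp_frob => //; lra.
move=> x _; rewrite normrM -!mulrA; apply: ler_pM => //.
  exact: ler_inv_bound.
apply: le_trans (mxdot_le_frob _ _) _; rewrite mulrA ler_wpM2r ?frob_ge0//.
by apply: le_trans (frob_dev _) _; rewrite frob_tensor.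
Qed.

Lemma ler_norm_OT (kappa1 : R) phi z om eta : 0 < kappa1 ->
  (forall t, kappa1 <= cond d t) -> in_Yv d z -> in_Y d om ->
  in_Lp_mx Omega 2%:E eta ->
  `|OT d phi z om eta| <=
  kappa1^-1 * c6 * Yv_norm d z * Y_norm d om * Lp_norm_mx Omega 2 eta.
Proof.
move=> k0 kc zY oY eL; rewrite /Y_norm -Lp_norm_norm.
apply: (ler_Rintegral_6_6_2 mOmega Omega_lty).
- by rewrite invr_ge0 ltW.
- by apply: in_Lp_frob => //; lra.
- exact: in_Lp_norm.
- by apply: in_Lp_frob => //; lra.
move=> x _; rewrite normrM -!mulrA; apply: ler_pM => //.
  exact: ler_inv_bound.
rewrite normrM mulrCA ler_wpM2l//; exact: mxdot_le_frob.
Qed.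

Lemma ler_norm_FS phi v : in_Lp_mx Omega +oo (grav d) -> in_Y d phi ->
  in_Yv d v.1 ->
  `|FS d phi v| <=
  Y_norm d phi * Yv_norm d v.1 * Lp_norm_mx Omega (3 / 2) (grav d).
Proof.
move=> gL pY vY; rewrite normrN /Y_norm -Lp_norm_norm.
apply: ler_Rintegral_6_32_6.
- exact: in_Lp_norm.
- apply: in_Lp_frob; first by lra.
  by move=> i j; apply: in_Linfty_in_Lp => //; lra.
- by apply: in_Lp_frob => //; lra.
move=> x _; rewrite normrM -mulrA ler_wpM2l// mulrC; exact: mxdot_le_frob.
Qed.

(* In both estimates the convective form is absorbed by half of the inf-sup
   constant, thanks to the bound on [z]. *)
Lemma apriori_S (mu1 alphaS : R) z phi s : 0 < mu1 ->
  (forall t, mu1 <= visc d t) -> in_Lp_mx Omega +oo (grav d) -> 0 < alphaS ->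
  inf_sup_S d phi alphaS -> in_Yv d z -> in_Y d phi ->
  Yv_norm d z <= mu1 * alphaS / (2 * c6) -> solution_S d z phi s ->
  S_norm d s <=
  2 / alphaS * Lp_norm_mx Omega (3 / 2) (grav d) * Y_norm d phi.
Proof.
move=> m0 mv gL a0 infsup zY pY zr [sS [h1 h2]].
set gn := Lp_norm_mx _ _ _; set S := S_norm d s.
have uY : in_Yv d s.2.1 by case: sS => _ [].
have gn0 : 0 <= gn by exact: Lp_norm_mx_ge0.
have p0 : 0 <= Y_norm d phi by exact: Lp_norm_ge0.
have S0 : 0 <= S by exact: S_norm_ge0.
have B0 : 0 <= alphaS / 2 * S + gn * Y_norm d phi.
  by rewrite addr_ge0 ?mulr_ge0// ltW// divr_gt0.
suff : alphaS * S <= alphaS / 2 * S + gn * Y_norm d phi.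
  move=> h; rewrite -(ler_pM2l a0).
  have -> : alphaS * (2 / alphaS * gn * Y_norm d phi) = 2 * (gn * Y_norm d phi).
    by field; rewrite gt_eqF.
  by lra.
rewrite -lee_fin; apply: le_trans (infsup _ sS) _.
apply: ge_ereal_sup => _ [[tau v] /= [[[tL2 t2 t3 t4] vZ] _] <-]; rewrite lee_fin.
set S' := S_norm d _; have S'0 : 0 <= S' by exact: S_norm_ge0.
have tX : in_XS d tau by split.
have vY : in_Yv d v.1 by case: vZ.
suff num : AS d phi s.1 tau + BS d tau s.2 + BS d s.1 v
    <= (alphaS / 2 * S + gn * Y_norm d phi) * S'.
  (* If the norm of the test element is 0, the quotient is 0 by the convention on division and [B0]
     concludes. *)
  move: S'0; rewrite le_eqVlt => /predU1P[<-|S'0]; first by rewrite invr0 mulr0.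
  by rewrite ler_pdivrMr.
(* The two equations turn the numerator into [FS] minus the convective form [OS]. *)
have := h1 _ tX; have := h2 _ vZ => -> eq1.
have OSle := ler_norm_OS phi m0 mv zY uY tL2.
have FSle := ler_norm_FS gL pY vY.
have tS' : Lp_norm_mx Omega 2 tau <= S'.
  by rewrite /S' /S_norm /XS_norm /Z_norm /= -addrA lerDl !addr_ge0 ?Lp_norm_mx_ge0.
have vS' : Yv_norm d v.1 <= S'.
  by rewrite /S' /S_norm /XS_norm /Z_norm /= addrCA lerDl !addr_ge0 ?Lp_norm_mx_ge0.
have uS : Yv_norm d s.2.1 <= S.
  by rewrite /S /S_norm /XS_norm /Z_norm /= addrCA lerDl !addr_ge0 ?Lp_norm_mx_ge0.
have zc : mu1^-1 * c6 * Yv_norm d z <= alphaS / 2.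
  (* The radius divides by [c6]; should [c6] vanish, so does the left-hand side. *)
  have [->|c0] := eqVneq c6 0; first by rewrite mulr0 mul0r divr_ge0 ?ltW.
  have cp : 0 < c6 by rewrite lt_def c0 powR_ge0.
  apply: (@le_trans _ _ (mu1^-1 * c6 * (mu1 * alphaS / (2 * c6)))).
    by rewrite ler_wpM2l// mulr_ge0 ?invr_ge0 ?powR_ge0// ltW.
  by rewrite le_eqVlt; apply/orP; left; apply/eqP; field; rewrite c0 gt_eqF.
have {}OSle : - OS d phi z s.2.1 tau <= alphaS / 2 * S * S'.
  rewrite -normrN in OSle; apply: le_trans (le_trans (ler_norm _) OSle) _.
  apply: ler_pM3 => //; do ?exact: Lp_norm_mx_ge0.
  by rewrite !mulr_ge0 ?invr_ge0 ?powR_ge0 ?Lp_norm_mx_ge0// ltW.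
have {}FSle : FS d phi v <= gn * Y_norm d phi * S'.
  apply: le_trans (le_trans (ler_norm _) FSle) _.
  rewrite (mulrC gn) [leRHS]mulrAC ler_wpM2r// ler_wpM2l//.
move: eq1 OSle FSle; rewrite mulrDl; lra.
Qed.

Lemma apriori_T (kappa1 alphaT phin : R) z phi t : 0 < kappa1 ->
  (forall t, kappa1 <= cond d t) -> 0 < alphaT -> 0 <= phin ->
  (forall eta, in_XT d eta -> `|FT d (bdry d) eta| <= phin * XT_norm d eta) ->
  inf_sup_T d phi alphaT -> in_Yv d z ->
  Yv_norm d z <= kappa1 * alphaT / (2 * c6) -> solution_T d z phi t ->
  T_norm d t <= 2 / alphaT * phin.
Proof.
move=> k0 kc a0 n0 FTle infsup zY zr [tT [h1 h2]].
set S := T_norm d t.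
have uY : in_Y d t.2 by case: tT.
have S0 : 0 <= S by exact: T_norm_ge0.
have B0 : 0 <= alphaT / 2 * S + phin.
  by rewrite addr_ge0 ?mulr_ge0// ltW// divr_gt0.
suff : alphaT * S <= alphaT / 2 * S + phin.
  move=> h; rewrite -(ler_pM2l a0).
  have -> : alphaT * (2 / alphaT * phin) = 2 * phin by field; rewrite gt_eqF.
  by lra.
rewrite -lee_fin; apply: le_trans (infsup _ tT) _.
apply: ge_ereal_sup => _ [[eta v] /= [[eX vY] _] <-]; rewrite lee_fin.
have eL : in_Lp_mx Omega 2%:E eta by case: eX.
set S' := T_norm d _; have S'0 : 0 <= S' by exact: T_norm_ge0.
suff num : AT d phi t.1 eta + BT d eta t.2 + BT d t.1 v
    <= (alphaT / 2 * S + phin) * S'.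
  move: S'0; rewrite le_eqVlt => /predU1P[<-|S'0]; first by rewrite invr0 mulr0.
  by rewrite ler_pdivrMr.
have := h1 _ eX; have := h2 _ vY => -> eq1.
have OTle := ler_norm_OT phi k0 kc zY uY eL.
have eS' : XT_norm d eta <= S' by rewrite /S' /T_norm lerDl Lp_norm_ge0.
have tS' : Lp_norm_mx Omega 2 eta <= S'.
  by apply: le_trans eS'; rewrite /XT_norm lerDl Lp_norm_ge0.
have uS : Y_norm d t.2 <= S.
  by rewrite /S /T_norm lerDr addr_ge0 ?Lp_norm_mx_ge0 ?Lp_norm_ge0.
have zc : kappa1^-1 * c6 * Yv_norm d z <= alphaT / 2.
  have [->|c0] := eqVneq c6 0; first by rewrite mulr0 mul0r divr_ge0 ?ltW.
  have cp : 0 < c6 by rewrite lt_def c0 powR_ge0.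
  apply: (@le_trans _ _ (kappa1^-1 * c6 * (kappa1 * alphaT / (2 * c6)))).
    by rewrite ler_wpM2l// mulr_ge0 ?invr_ge0 ?powR_ge0// ltW.
  by rewrite le_eqVlt; apply/orP; left; apply/eqP; field; rewrite c0 gt_eqF.
have {}OTle : - OT d phi z t.2 eta <= alphaT / 2 * S * S'.
  rewrite -normrN in OTle; apply: le_trans (le_trans (ler_norm _) OTle) _.
  apply: ler_pM3 => //; do ?exact: Lp_norm_mx_ge0; do ?exact: Lp_norm_ge0.
  by rewrite !mulr_ge0 ?invr_ge0 ?powR_ge0 ?Lp_norm_mx_ge0// ltW.
have FTle' : FT d (bdry d) eta <= phin * S'.
  apply: le_trans (le_trans (ler_norm _) (FTle _ eX)) _.
  by rewrite ler_wpM2l.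
move: eq1 OTle FTle'; rewrite mulrDl; lra.
Qed.

End Forms.

(** * The fixed point *)

Section FixedPoint.
Context {R : realType}.
Variable d : boussinesq_data R.
Local Notation Omega := (dom d).
Local Notation W := (@vector_field R * @scalar_field R)%type.
Implicit Types p q r : W.

Lemma W_norm_ge0 p : 0 <= W_norm d p.
Proof. by rewrite addr_ge0 ?Lp_norm_ge0 ?Lp_norm_mx_ge0. Qed.

Lemma W_norm_subC p q : W_norm d (W_sub p q) = W_norm d (W_sub q p).
Proof. by congr (_ + _); [exact: Lp_norm_mxC|exact: Lp_norm_subC]. Qed.

Lemma W_norm_triangle p q r : in_Yv d p.1 -> in_Y d p.2 -> in_Yv d q.1 ->
  in_Y d q.2 -> in_Yv d r.1 -> in_Y d r.2 ->
  W_norm d (W_sub p r) <= W_norm d (W_sub p q) + W_norm d (W_sub q r).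
Proof.
move=> p1 p2 q1 q2 r1 r2; rewrite /W_norm addrACA; apply: lerD.
  by apply: (Lp_norm_mx_triangle _ p1 q1 r1); lra.
by apply: (Lp_norm_triangle _ p2 q2 r2); lra.
Qed.

Lemma W_sub0 p : W_sub p VS_zero = p.
Proof. by case: p => z phi; congr pair; apply/funext => x /=; rewrite subr0. Qed.

Lemma ae_eq_on_sub0 (V : zmodType) (f g : R * R -> V) :
  ae_eq_on Omega (fun x => f x - g x) (fun=> 0) -> ae_eq_on Omega f g.
Proof. by apply: filterS => x /[apply] /eqP; rewrite subr_eq0 => /eqP. Qed.

Lemma W_norm_sub_eq0 p q : in_Yv d p.1 -> in_Y d p.2 -> in_Yv d q.1 ->
  in_Y d q.2 -> W_norm d (W_sub p q) = 0 -> VS_eq d p q.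
Proof.
move=> p1 p2 q1 q2 /eqP; have o6 : 1 <= 6 :> R by lra.
rewrite paddr_eq0 ?Lp_norm_ge0 ?Lp_norm_mx_ge0// => /andP[/eqP e1 /eqP e2].
split; apply: ae_eq_on_sub0.
  exact: Lp_norm_mx_eq0 o6 (in_Lp_mxB o6 p1 q1) e1.
by apply: Lp_norm_eq0 (in_LpB o6 p2 q2) e2; lra.
Qed.

Lemma W_norm_sub_ae p p' q q' : VS_eq d p p' -> VS_eq d q q' ->
  W_norm d (W_sub p q) = W_norm d (W_sub p' q').
Proof.
move=> [p1 p2] [q1 q2]; congr (_ + _).
  apply: Lp_norm_mx_ae_eq; first by lra.
  by apply: filterS2 p1 q1 => x h1 h2 Ox /=; rewrite h1// h2.
apply: Lp_norm_ae_eq; first by lra.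
by apply: filterS2 p2 q2 => x h1 h2 Ox /=; rewrite h1// h2.
Qed.

(** Each passage to the limit along the iterates is stated as an inequality valid for all [n] and
    concluded here, so that no topology on the space of fields is involved. *)
Lemma ler_geometric_error (A C k x : R) : 0 <= k < 1 ->
  (forall n, x <= A + C * k ^+ n) -> x <= A.
Proof.
move=> /andP[k0 k1] xA.
have kn : (fun n => A + C * k ^+ n) @ \oo --> A + C * 0.
  apply: cvgD; first exact: cvg_cst.
  by apply: cvgM; [exact: cvg_cst|apply: cvg_expr; rewrite ger0_norm].
rewrite -[leRHS]addr0 -(mulr0 C) -(cvg_lim _ kn)//.
by apply: limr_ge; [apply/cvg_ex; eexists; exact: kn|exact: nearW].
Qed.

Hypothesis mOmega :
  measurable (Omega : set (measurableTypeR R * measurableTypeR R)).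

Lemma W_ball0 (rad : R) : 0 <= rad -> W_ball d rad VS_zero.
Proof.
move=> r0; have E : (fun=> 0) \_ Omega = cst 0 :> (R * R -> R).
  by apply/funext => x; rewrite /patch; case: ifP.
have N0 : Lnorm leb2 6%:E (EFin \o ((fun=> 0) \_ Omega)) = 0%E.
  by rewrite E Lnorm0// eqe gt_eqF//; lra.
have Lp0 : in_Lp Omega 6%:E (fun=> 0 : R).
  by apply: in_LpI; [rewrite E; exact: measurable_cst|rewrite N0].
have z1 : in_Yv d (VS_zero (R := R)).1.
  by move=> i j; under eq_fun do rewrite mxE.
split=> //; suff -> : W_norm d VS_zero = 0 by [].
rewrite /W_norm /Yv_norm /Lp_norm_mx; under eq_fun do rewrite frob0.
by rewrite /Y_norm /Lp_norm N0 addr0.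
Qed.

(** The contraction estimate also makes [F] send almost everywhere equal points of the ball to
    almost everywhere equal ones, so it is compatible with [VS_eq]. *)
Lemma W_contraction_fixpoint (F : W -> W) (rad k : R) : 0 <= rad ->
  0 <= k < 1 -> (forall p, W_ball d rad p -> W_ball d rad (F p)) ->
  (forall p q, W_ball d rad p -> W_ball d rad q ->
    W_norm d (W_sub (F p) (F q)) <= k * W_norm d (W_sub p q)) ->
  exists p, [/\ W_ball d rad p, VS_eq d (F p) p &
    forall q, W_ball d rad q -> VS_eq d (F q) q -> VS_eq d p q].
Proof.
move=> rad0 k01 FW Fk; have /andP[k0 k1] := k01.
have o6 : 1 <= 6 :> R by lra.
pose p n := iter n F VS_zero.
have pW n : W_ball d rad (p n).
  by elim: n => [|n IH]; [exact: W_ball0|rewrite /p iterS; exact: FW].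
have p1 n : in_Yv d (p n).1 by case: (pW n).
have p2 n : in_Y d (p n).2 by case: (pW n).
pose c := W_norm d (W_sub (p 1%N) (p 0%N)).
have c0 : 0 <= c by exact: W_norm_ge0.
have pc n : W_norm d (W_sub (p n.+1) (p n)) <= c * k ^+ n.
  elim: n => [|n IH]; first by rewrite mulr1.
  apply: le_trans (Fk _ _ (pW n.+1) (pW n)) _.
  by rewrite exprS mulrCA ler_wpM2l.
have [n|u uY [C C0 uC]] := Lp_mx_geometric_limit mOmega o6 c0 k01 p1.
  apply: le_trans (pc n); by rewrite /W_norm lerDl Lp_norm_ge0.
have [n|phi phiY phiC] := Lp_norm_geometric_limit mOmega o6 c0 k01 p2.
  apply: le_trans (pc n); by rewrite /W_norm lerDr Lp_norm_mx_ge0.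
pose q : W := (u, phi).
pose D := C + c / (1 - k).
have pq n : W_norm d (W_sub (p n) q) <= D * k ^+ n.
  rewrite mulrDl; apply: lerD; first exact: uC.
  by rewrite mulrAC; exact: phiC.
have [z1 z2 _] := W_ball0 rad0.
(* The ball is closed: the norm of [q] is at most [rad + D * k ^+ n] for every [n]. *)
have qW : W_ball d rad q.
  split=> //; apply: (@ler_geometric_error _ D k) => // n.
  rewrite -(W_sub0 q).
  apply: le_trans (W_norm_triangle (q := p n) _ _ _ _ _ _) _ => //.
  rewrite W_sub0 addrC; apply: lerD; first by case: (pW n).
  by rewrite W_norm_subC.
have [Fq1 Fq2 _] := FW _ qW.
(* The iterate [p n.+1 = F (p n)] is inserted between [F q] and [q]; each of the two distances is at
   most [D * k ^+ n]. *)
have Fqq : VS_eq d (F q) q.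
  apply: W_norm_sub_eq0 => //; apply/eqP; rewrite eq_le W_norm_ge0 andbT.
  apply: (@ler_geometric_error _ (D + D) k) => // n; rewrite add0r.
  apply: le_trans (W_norm_triangle (q := p n.+1) _ _ _ _ _ _) _ => //.
  rewrite mulrDl; apply: lerD.
    apply: le_trans (Fk _ _ qW (pW n)) _; rewrite W_norm_subC.
    apply: le_trans (pq n); rewrite ler_piMl ?W_norm_ge0 ?ltW//.
  apply: le_trans (pq _) _; rewrite ler_wpM2l//.
    by rewrite addr_ge0// divr_ge0// subr_ge0 ltW.
  by rewrite exprS ler_piMl ?exprn_ge0// ltW.
exists q; split=> // r rW Frr; have [r1 r2 _] := rW.
apply: W_norm_sub_eq0 => //; apply/eqP; rewrite eq_le W_norm_ge0 andbT.
(* The distance of two fixed points is at most [k] times itself, with [k < 1]. *)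
have := Fk _ _ qW rW; rewrite (W_norm_sub_ae Fqq Frr) => h.
have := W_norm_ge0 (W_sub q r); nra.
Qed.

End FixedPoint.

(** * Well-posedness of the coupled problem *)

Lemma inf_ge0 (R : realType) (A : set R) : (forall x, A x -> 0 <= x) -> 0 <= inf A.
Proof.
move=> A0; have [->|/set0P[x Ax]] := eqVneq A set0; first by rewrite inf0.
by apply: lb_le_inf; [exists x|move=> y /A0].
Qed.

Theorem theorem3p6 (R : realType) (d : boussinesq_data R)
    (mu1 mu2 Lmu kappa1 kappa2 Lkappa : R)
    (alphaS alphaT eps Ceps Ceps' cD Lip : R) :
  let Omega := dom d in
  let r1 := mu1 * alphaS / (2 * fine (leb2 Omega) `^ 6^-1) in
  let r2 := kappa1 * alphaT / (2 * fine (leb2 Omega) `^ 6^-1) in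
  let Rad := Num.min r1 r2 in
  let gn := Lp_norm_mx Omega (3 / 2) (grav d) in
  let Hhalf phi := cD * Hhalf_norm Omega (edges d) (GammaD d) phi in
  let phin := Hhalf (bdry d) in
  let phineps := Hhalfs_norm Omega (edges d) eps (GammaD d) (bdry d) in
  polygonal_domain Omega (edges d) ->
  GammaD d `|` GammaN d = closure Omega `\` Omega° ->
  in_Lp_mx Omega +oo (grav d) ->
  in_Hhalf Omega (edges d) (GammaD d) (bdry d) ->
  0 < mu1 -> (forall t, mu1 <= visc d t <= mu2) -> Lmu.-lipschitz (visc d) ->
  0 < kappa1 -> (forall t, kappa1 <= cond d t <= kappa2) ->
  Lkappa.-lipschitz (cond d) ->
  0 < cD ->
  (forall phi, in_Hhalf Omega (edges d) (GammaD d) phi ->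
    forall eta, in_XT d eta -> `|FT d phi eta| <= Hhalf phi * XT_norm d eta) ->
  0 < alphaS -> (forall phi, in_Y d phi -> inf_sup_S d phi alphaS) ->
  0 < alphaT -> (forall phi, in_Y d phi -> inf_sup_T d phi alphaT) ->
  (forall z phi, in_Yv d z -> in_Y d phi -> Yv_norm d z <= r1 ->
    (exists s, solution_S d z phi s) /\
    (forall s s', solution_S d z phi s -> solution_S d z phi s' ->
      S_eq d s s')) ->
  (forall z phi, in_Yv d z -> in_Y d phi -> Yv_norm d z <= r2 ->
    (exists t, solution_T d z phi t) /\
    (forall t t', solution_T d z phi t -> solution_T d z phi t' ->
      VS_eq d t t')) ->
  3^-1 <= eps < 1 -> 0 < Ceps -> 0 < Ceps' ->
  in_Hhalfs Omega (edges d) eps (GammaD d) (bdry d) ->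
  (forall z phi, in_Yv d z -> in_Y d phi -> Yv_norm d z <= r1 ->
    [/\ in_Wsp_mx Omega eps 2 (LS d z phi).1,
        in_Wsp_mx Omega eps 6 (LS d z phi).2.1 &
        Wsp_norm_mx Omega eps 2 (LS d z phi).1
          + Wsp_norm_mx Omega eps 6 (LS d z phi).2.1
        <= Ceps * gn * Y_norm d phi]) ->
  (forall z phi, in_Yv d z -> in_Y d phi -> Yv_norm d z <= r2 ->
    [/\ in_Wsp_mx Omega eps 2 (LT d z phi).1,
        in_Wsp Omega eps 6 (LT d z phi).2 &
        Wsp_norm_mx Omega eps 2 (LT d z phi).1
          + Wsp_norm Omega eps 6 (LT d z phi).2
        <= Ceps' * phineps]) ->
  0 < Lip ->
  (forall p q, W_ball d Rad p -> W_ball d Rad q ->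
    W_norm d (W_sub (L d p) (L d q)) <=
    Lip * ((gn + (1 + gn * (1 + phin)) * phin) * Yv_norm d (W_sub p q).1
           + (1 + gn * (1 + phin)) * (1 + phineps) * Y_norm d (W_sub p q).2)) ->
  (1 + 2 / alphaS * gn) * (2 / alphaT) * phin <= Rad ->
  Lip * ((gn + (1 + gn * (1 + phin)) * phin)
         + (1 + gn * (1 + phin)) * (1 + phineps)) < 1 ->
  [/\ exists p, [/\ W_ball d Rad p, VS_eq d (L d p) p &
        forall q, W_ball d Rad q -> VS_eq d (L d q) q -> VS_eq d p q],
      forall u phi, W_ball d Rad (u, phi) ->
        (VS_eq d (L d (u, phi)) (u, phi) <->
         exists sigma gamma rho, solution_P d (sigma, (u, gamma)) (rho, phi)) &
      exists s t,
        [/\ solution_P d s t,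
            W_ball d Rad (s.2.1, t.2),
            (forall s' t', solution_P d s' t' -> W_ball d Rad (s'.2.1, t'.2) ->
               S_eq d s s' /\ VS_eq d t t'),
            S_norm d s <= 4 / (alphaS * alphaT) * phin * gn &
            T_norm d t <= 2 / alphaT * phin]].
Proof.
move=> Omega r1 r2 Rad gn Hhalf phin phineps poly _ gL bH mu0 muv _ ka0 kav _ cD0.
move=> FTle aS0 infS aT0 infT LSwd LTwd _ _ _ _ _ _ Lip0 LipL small contr.
have mO : measurable (Omega : set (measurableTypeR R * measurableTypeR R)).
  exact: open_measurable_plane (poly_open poly).
have Ooo : (leb2 Omega < +oo)%E by exact: bounded_leb2_lty (poly_bounded poly) mO.
have muv1 t : mu1 <= visc d t by case/andP: (muv t).
have kav1 t : kappa1 <= cond d t by case/andP: (kav t).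
have gn0 : 0 <= gn by exact: Lp_norm_mx_ge0.
have phin0 : 0 <= phin.
  by rewrite mulr_ge0 ?(ltW cD0)//; apply: inf_ge0 => _ [w _ <-]; exact: sqrtr_ge0.
have phineps0 : 0 <= phineps.
  by apply: inf_ge0 => _ [w _ <-]; exact: sqrtr_ge0.
have Rad_r1 : Rad <= r1 by rewrite ge_min lexx.
have Rad_r2 : Rad <= r2 by rewrite ge_min lexx orbT.
(* The radius dominates the left-hand side of the first smallness condition, which is
   nonnegative. *)
have Rad0 : 0 <= Rad.
  apply: le_trans (small); have aS1 := ltW aS0; have aT1 := ltW aT0.
  have pos2 x : 0 <= x -> 0 <= 2 / x by move=> x0; exact: divr_ge0.
  apply: mulr_ge0 => //; apply: mulr_ge0; last exact: pos2.
  by rewrite addr_ge0// mulr_ge0// pos2.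
have ballY p : W_ball d Rad p -> Yv_norm d p.1 <= Rad.
  by case=> _ _; apply: le_trans; rewrite lerDl Lp_norm_ge0.
(* Existence of a solution guarantees that the element picked by [xget] is one, and not the default
   value. *)
have LSsol z phi : in_Yv d z -> in_Y d phi -> Yv_norm d z <= Rad ->
    solution_S d z phi (LS d z phi).
  move=> zY pY zR; have [[s sS] _] := LSwd _ _ zY pY (le_trans zR Rad_r1).
  exact: (xgetPex (P := [set s | solution_S d z phi s]) S_zero (ex_intro _ s sS)).
have LTsol z phi : in_Yv d z -> in_Y d phi -> Yv_norm d z <= Rad ->
    solution_T d z phi (LT d z phi).
  move=> zY pY zR; have [[t tT] _] := LTwd _ _ zY pY (le_trans zR Rad_r2).
  exact: (xgetPex (P := [set t | solution_T d z phi t]) VS_zero (ex_intro _ t tT)).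
have Sle z phi s : in_Yv d z -> in_Y d phi -> Yv_norm d z <= Rad ->
    solution_S d z phi s -> S_norm d s <= 2 / alphaS * gn * Y_norm d phi.
  move=> zY pY zR; have zr1 := le_trans zR Rad_r1.
  exact: (apriori_S mO Ooo mu0 muv1 gL aS0 (infS _ pY) zY pY zr1).
have Tle z phi t : in_Yv d z -> in_Y d phi -> Yv_norm d z <= Rad ->
    solution_T d z phi t -> T_norm d t <= 2 / alphaT * phin.
  move=> zY pY zR; have zr2 := le_trans zR Rad_r2.
  exact: (apriori_T mO Ooo ka0 kav1 aT0 phin0 (FTle _ bH) (infT _ pY) zY zr2).
have Y_T (t : @vector_field R * @scalar_field R) : Y_norm d t.2 <= T_norm d t.
  by rewrite /T_norm lerDr addr_ge0 ?Lp_norm_ge0 ?Lp_norm_mx_ge0.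
have Yv_S (s : @tensor_field R * (@vector_field R * @tensor_field R)) :
    Yv_norm d s.2.1 <= S_norm d s.
  by rewrite /S_norm /Z_norm /XS_norm addrCA lerDl !addr_ge0 ?Lp_norm_mx_ge0.
have L_ball p : W_ball d Rad p -> W_ball d Rad (L d p).
  move=> pW; have [zY pY _] := pW; have zR := ballY _ pW.
  have Tsol := LTsol _ _ zY pY zR.
  have tY : in_Y d (LT d p.1 p.2).2 by case: Tsol => -[].
  have Ssol := LSsol _ _ zY tY zR; split=> //=.
    by case: Ssol => -[_ []].
  have tle := le_trans (Y_T _) (Tle _ _ _ zY pY zR Tsol).
  have sle := le_trans (Yv_S _) (Sle _ _ _ zY tY zR Ssol).
  (* The temperature is at most [2 / alphaT * phin] and the velocity at most [2 / alphaS * gn] times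
     that; their sum is the left-hand side of the first smallness condition. *)
  apply: le_trans (small); rewrite /W_norm -mulrA mulrDl mul1r addrC.
  apply: lerD => //; apply: le_trans sle _.
  by rewrite ler_wpM2l// mulr_ge0// divr_ge0// ltW.
set A := gn + _ in contr LipL.
set B := (1 + gn * (1 + phin)) * (1 + phineps) in contr LipL.
have [A0 B0] : 0 <= A /\ 0 <= B.
  by split; repeat first [assumption | exact: ler01 | apply: addr_ge0
                         | apply: mulr_ge0].
have k01 : 0 <= Lip * (A + B) < 1 
  by rewrite contr andbT; apply: mulr_ge0; [exact: ltW|exact: addr_ge0].
clearbody A B.
have L_contr p q : W_ball d Rad p -> W_ball d Rad q ->
    W_norm d (W_sub (L d p) (L d q)) <= Lip * (A + B) * W_norm d (W_sub p q).
  move=> pW qW; apply: le_trans (LipL _ _ pW qW) _.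
  rewrite -mulrA ler_wpM2l ?(ltW Lip0)//.
  have y0 : 0 <= Yv_norm d (W_sub p q).1 by exact: Lp_norm_mx_ge0.
  have s0 : 0 <= Y_norm d (W_sub p q).2 by exact: Lp_norm_ge0.
  (* Adding the two cross terms bounds the weighted sum of the distances by [A + B] times their
     sum. *)
  have := mulr_ge0 A0 s0; have := mulr_ge0 B0 y0.
  by rewrite /W_norm mulrDl !mulrDr; lra.
have fixP u phi : W_ball d Rad (u, phi) ->
    (VS_eq d (L d (u, phi)) (u, phi) <->
     exists sigma gamma rho, solution_P d (sigma, (u, gamma)) (rho, phi)).
  move=> pW; have [/= uY pY _] := pW; have uR := ballY _ pW.
  have Tsol := LTsol _ _ uY pY uR.
  have tY : in_Y d (LT d u phi).2 by case: Tsol => -[].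
  have Ssol := LSsol _ _ uY tY uR.
  split=> [[/= eu ephi]|[sigma [gamma [rho /solution_PE[sS tT]]]]].
    (* The stress, rotation and flux are those computed by the decoupled solvers; velocity and
       temperature are replaced by [u] and [phi], equal to them almost everywhere. *)
    exists (LS d u (LT d u phi).2).1, (LS d u (LT d u phi).2).2.2, (LT d u phi).1.
    apply/solution_PE; split.
      move: Ssol; case: (LS _ _ _) eu => sigma [u' gam] /= eu.
      exact: solution_S_ae (ae_eq_refl _ _ _) ephi eu uY.
    move: Tsol; case: (LT _ _ _) ephi => rho phi' /= ephi.
    exact: solution_T_ae (ae_eq_refl _ _ _) (ae_eq_refl _ _ _) ephi pY.
  (* The temperature is identified before the velocity, because [L] feeds the new temperature into
     the flow problem; only then can the flow part of the solution be compared with [LS]. *)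
  have [_ Tuniq] := LTwd _ _ uY pY (le_trans uR Rad_r2).
  have [_ e2] := Tuniq _ _ Tsol tT.
  have [_ Suniq] := LSwd _ _ uY tY (le_trans uR Rad_r1).
  have sS' : solution_S d u (LT d u phi).2 (sigma, (u, gamma)).
    apply: solution_S_ae sS => //.
    - exact: ae_eq_refl.
    - exact: ae_eq_sym.
    - exact: ae_eq_refl.
  by have [_ e1 _] := Suniq _ _ Ssol sS'; split.
have [p [pW Lpp puniq]] := W_contraction_fixpoint mO Rad0 k01 L_ball L_contr.
split=> //; first by exists p.
case: p pW Lpp puniq => u phi pW Lpp puniq.
have [sigma [gamma [rho sol]]] := (fixP _ _ pW).1 Lpp.
have [/= uY pY _] := pW; have uR := ballY _ pW.
have /solution_PE[sS tT] := sol.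
have tle := Tle _ _ _ uY pY uR tT.
exists (sigma, (u, gamma)), (rho, phi); split=> //.
  move=> [sigma' [u' gamma']] [rho' phi'] sol' pW' /=.
  have Lpp' : VS_eq d (L d (u', phi')) (u', phi').
    by apply/(fixP _ _ pW'); exists sigma', gamma', rho'.
  have [/= eu ephi] := puniq _ pW' Lpp'.
  have /solution_PE[sS' tT'] := sol'.
  have eu' := ae_eq_sym eu; have ephi' := ae_eq_sym ephi.
  have [_ Suniq] := LSwd _ _ uY pY (le_trans uR Rad_r1).
  have [_ Tuniq] := LTwd _ _ uY pY (le_trans uR Rad_r2).
  have u'Y : in_Yv d u' by case: pW'.
  have phi'Y : in_Y d phi' by case: pW'.
  (* The second solution, rewritten with the coefficients [u] and [phi] of the first, solves the
     same decoupled problems; their uniqueness identifies the remaining components. *)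
  split.
    apply: Suniq sS _; apply: solution_S_ae sS' => //; exact: ae_eq_refl.
  apply: Tuniq tT _; apply: solution_T_ae tT' => //; exact: ae_eq_refl.
apply: le_trans (Sle _ _ _ uY pY uR sS) _.
have Yle := le_trans (Y_T (rho, phi)) tle.
(* The flow estimate is linear in the temperature, itself bounded by the thermal estimate; the 4 is
   the product of the two absorption factors 2. *)
have -> : 4 / (alphaS * alphaT) * phin * gn = 2 / alphaS * gn * (2 / alphaT * phin).
  by field; rewrite !gt_eqF.
by rewrite ler_wpM2l// mulr_ge0// divr_ge0// ltW.
Qed.
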